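(* Let $\mu\in X(\Bbbk)$, let $Z\subseteq X$ be an irreducible component containing $\mu$, let $Z_{\mathrm{red}}$ be its reduced subscheme, and assume that $\mu$ is a smooth point of $Z_{\mathrm{red}}$. If $\mu$ is anisotropic, then the orbit $G\cdot\mu$ is Zariski open in $Z_{\mathrm{red}}$.
   Context: $\Bbbk$ is an algebraically closed field of characteristic $0$, $W$ is a finite-dimensional $\Bbbk$-vector space, and $G=\mathrm{GL}(W)$ acts on $\mathrm{Hom}_\Bbbk(W\otimes W,W)$ by $(g\cdot\mu)(x,y)=g\,\mu(g^{-1}x,g^{-1}y)$; $\mathfrak g=\mathrm{Lie}(G)=\mathrm{End}(W)$. $A_W$ denotes one of the $G$-representations $\mathrm{Hom}(W^{\otimes 2},W)$, $\mathrm{Hom}(\mathrm{Sym}^2W,W)$, $\mathrm{Hom}(\Lambda^2W,W)$, also viewed as an affine space. $Q\subseteq \mathrm{Sym}^2(A_W^\vee)$ is a fixed $G$-stable subspace; each $q\in Q$ is regarded as a symmetric bilinear form $q(\nu_1,\nu_2)$ on $A_W$, with associated quadratic polynomial $f_q(\nu)=q(\nu,\nu)$. $X=\mathrm{Var}(Q)\subseteq A_W$ is the closed subscheme defined by the equations $f_q=0$, $q\in Q$. $\Theta\colon A_W\times A_W\to Q^\vee$ is the bilinear map $\Theta(\mu,\nu)(q)=q(\mu,\nu)$. For $\mu\in X(\Bbbk)$ put $\Phi_\mu\colon A_W\to Q^\vee$, $\Phi_\mu(\nu)=\Theta(\mu,\nu)$, and $\delta_\mu\colon\mathfrak g\to A_W$,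 $\delta_\mu(\xi)=\xi\cdot\mu$ (infinitesimal action). One has $\Phi_\mu\circ\delta_\mu=0$; set $H^2_{\mathrm{inc}}(\mu)=\ker(\Phi_\mu)/\mathrm{im}(\delta_\mu)$ and $H^3_{\mathrm{inc}}(\mu)=\mathrm{coker}(\Phi_\mu)$. The assignment $[\alpha]\mapsto[\Theta(\alpha,\alpha)]$ ($\alpha\in\ker\Phi_\mu$) is a well-defined quadratic map $\kappa^{\mathrm{inc}}_{2,\mu}\colon H^2_{\mathrm{inc}}(\mu)\to H^3_{\mathrm{inc}}(\mu)$. The point $\mu$ is called anisotropic if $\kappa^{\mathrm{inc}}_{2,\mu}([\alpha])=0$ implies $[\alpha]=0$. *)

(* Defs.v *)
From HB Require Import structures.
From mathcomp Require Import all_boot all_order all_algebra.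
From mathcomp Require Import generic_quotient ring_quotient.
From mathcomp Require Import ring.
From mathcomp.multinomials Require Import mpoly.

Set Implicit Arguments.
Unset Strict Implicit.
Unset Printing Implicit Defensive.

Import GRing.Theory.
Local Open Scope ring_scope.
Local Open Scope quotient_scope.

(* Zariski geometry on the k-points of the affine space of a vector space V,
   for k algebraically closed: a closed subset is identified with its set of
   k-points, given as a predicate on V. *)
Section ZariskiGeometry.

Variables (k : fieldType) (V : vectType k).

Local Notation n := (\dim (fullv : {vspace V})).

Definition coords (v : V) : 'I_n -> k :=
  fun i => coord (vbasis (fullv : {vspace V})) i v.

Definition peval (p : {mpoly k[n]}) (v : V) : k := p.@[coords v].

(* The differential of p at x, applied to v. *)
Definition pdiff (p : {mpoly k[n]}) (x v : V) : k :=
  \sum_(i < n) peval (p^`M(i)) x * coords v i.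

Definition zclosed (Z : V -> Prop) : Prop :=
  exists S : {mpoly k[n]} -> Prop,
    forall v, Z v <-> (forall p, S p -> peval p v = 0).

Definition zsub (Y Z : V -> Prop) : Prop := forall v, Y v -> Z v.

Definition zproper (Y Z : V -> Prop) : Prop := zsub Y Z /\ ~ zsub Z Y.

Definition irreducible (Z : V -> Prop) : Prop :=
  (exists v, Z v) /\
  forall C D : V -> Prop, zclosed C -> zclosed D ->
    (forall v, Z v -> C v \/ D v) -> zsub Z C \/ zsub Z D.

Definition irreducible_closed (Z : V -> Prop) : Prop :=
  zclosed Z /\ irreducible Z.

Definition irreducible_component (X Z : V -> Prop) : Prop :=
  [/\ irreducible_closed Z, zsub Z X
    & forall Y, irreducible_closed Y -> zsub Y X -> zsub Z Y -> zsub Y Z].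

Definition open_in (Z O : V -> Prop) : Prop :=
  exists2 C : V -> Prop, zclosed C & forall v, O v <-> Z v /\ ~ C v.

Definition vanishing_ideal (Z : V -> Prop) (p : {mpoly k[n]}) : Prop :=
  forall v, Z v -> peval p v = 0.

(* Zariski tangent space at x of the reduced closed subscheme of V whose set
   of points is Z: its ideal is the full vanishing ideal of Z. *)
Definition tangent (Z : V -> Prop) (x v : V) : Prop :=
  forall p, vanishing_ideal Z p -> pdiff p x v = 0.

Definition irreducible_chain (Z : V -> Prop) (d : nat) : Prop :=
  exists C : nat -> V -> Prop,
    (forall i, (i <= d)%N -> irreducible_closed (C i) /\ zsub (C i) Z) /\
    (forall i, (i < d)%N -> zproper (C i) (C i.+1)).

Definition krull_dim (Z : V -> Prop) (d : nat) : Prop :=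
  irreducible_chain Z d /\ forall e, irreducible_chain Z e -> (e <= d)%N.

Definition tangent_dim (Z : V -> Prop) (x : V) (d : nat) : Prop :=
  exists2 T : {vspace V}, (forall v, v \in T <-> tangent Z x v) & \dim T = d.

(* Smoothness at x of the reduced closed subscheme Z, for Z irreducible and k
   algebraically closed: the dimension of Z at x is then that of Z. *)
Definition smooth_point (Z : V -> Prop) (x : V) : Prop :=
  Z x /\ exists2 d, krull_dim Z d & tangent_dim Z x d.

End ZariskiGeometry.

Section LinearFunctions.

Variables (k : fieldType) (T U : vectType k).

Lemma linfunE (f : T -> U) : linear f -> linfun f =1 f.
Proof.
move=> f_lin.
pose fh := HB.pack_for {linear T -> U} f
  (GRing.isLinear.Build k T U *:%R f f_lin).
exact: (lfunE fh).
Qed.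

End LinearFunctions.

Section Polarization.

Variables (k : fieldType) (char0 : [pchar k] =i pred0).

Lemma poly_fun_eq0 (p : {poly k}) : (forall t, p.[t] = 0) -> p = 0.
Proof.
move=> p0; apply/eqP/negPn/negP => pn0.
pose rs := [seq (i%:R : k) | i <- iota 0 (size p)].
have natI : injective (fun i : nat => i%:R : k).
  suff H i j : (i <= j)%N -> i%:R = j%:R :> k -> i = j.
    by move=> i j ij; case/orP: (leq_total i j) => /H; [|move=> h; apply/esym]; auto.
  move=> lij /esym/eqP; rewrite -subr_eq0 -natrB // (pcharf0P k).1 // subn_eq0 => lji.
  by apply/eqP; rewrite eqn_leq lij lji.
have := @max_poly_roots _ p rs pn0; rewrite size_map size_iota ltnn => H.
suff: false by []. apply: H; last by rewrite map_inj_uniq // iota_uniq.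
by apply/allP => x _; rewrite /root p0.
Qed.

Lemma coef_memv (V : vectType k) (Q : {vspace V}) (I : finType) (e : I -> nat)
    (C : I -> V) (r : {poly k}) (d : nat) : r != 0 ->
  (forall t, r.[t] != 0 -> \sum_i t ^+ e i *: C i \in Q) ->
  \sum_(i | e i == d) C i \in Q.
Proof.
move=> rn0 CQ; pose f v := v - projv Q v.
have fQ v : (v \in Q) = (f v == 0).
  rewrite subr_eq0; apply/idP/eqP => [vQ | ->]; first by rewrite projv_id.
  exact: memv_proj.
have flin : linear f.
  by move=> a u v; rewrite /f linearP scalerBr opprD addrACA.
pose F : {linear V -> V} := HB.pack_for {linear V -> V} f
  (GRing.isLinear.Build k V V *:%R f flin).
have fF v : f v = F v by [].
pose b := vbasis {:V}.
rewrite fQ fF; set v := \sum_(_ | _) _.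
rewrite (coord_vbasis (memvf (F v))) big1 // => j _.
pose P := \sum_i coord b j (F (C i)) *: 'X^(e i).
suff P0 : P = 0.
  have : P`_d = 0 by rewrite P0 coef0.
  rewrite /P coef_sum /v !linear_sum big_mkcond /= => Pd.
  suff -> : \sum_(i | e i == d) coord b j (F (C i)) = 0 by rewrite scale0r.
  rewrite -[RHS]Pd big_mkcond; apply: eq_bigr => i _.
  by rewrite coefZ coefXn eq_sym; case: eqP; rewrite ?mulr1 ?mulr0.
have : P * r = 0.
  apply: poly_fun_eq0 => t; rewrite hornerM.
  have [-> | rt] := eqVneq r.[t] 0; first by rewrite mulr0.
  have := CQ t rt; rewrite fQ fF => /eqP F0.
  suff -> : P.[t] = 0 by rewrite mul0r.
  have : coord b j (F (\sum_i t ^+ e i *: C i)) = 0 by rewrite F0 linear0.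
  rewrite !linear_sum => {1}<-; rewrite /P horner_sum; apply: eq_bigr => i _.
  by rewrite hornerZ hornerXn !linearZ /= mulrC.
by move/eqP; rewrite mulf_eq0 (negPf rn0) orbF => /eqP.
Qed.

End Polarization.

(* Bilinear maps T x T -> U, i.e. linear maps from the tensor square of T to U,
   are represented in curried form by 'Hom(T, 'Hom(T, U)). *)
Section Symmetry.

Variables (k : fieldType) (T U : vectType k).
Implicit Types m : 'Hom(T, 'Hom(T, U)).

Definition bilin_flip m : 'Hom(T, 'Hom(T, U)) :=
  linfun (fun x => linfun (fun y => m y x)).

Definition symmetric_bilin : {vspace 'Hom(T, 'Hom(T, U))} :=
  lker (linfun (fun m => m - bilin_flip m)).

(* These are the alternating maps when the characteristic is not 2. *)
Definition skew_bilin : {vspace 'Hom(T, 'Hom(T, U))} :=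
  lker (linfun (fun m => m + bilin_flip m)).

Lemma bilin_flipE m x y : bilin_flip m x y = m y x.
Proof.
have fE x' : linfun (fun y' => m y' x') =1 (fun y' => m y' x').
  by apply: linfunE => a u v; rewrite linearP /= add_lfunE scale_lfunE.
rewrite linfunE ?fE // => a u v; apply/lfunP => z.
by rewrite add_lfunE scale_lfunE !fE linearP.
Qed.

Lemma bilin_flip_linear : linear bilin_flip.
Proof.
move=> a m1 m2; apply/lfunP => x; apply/lfunP => y.
by rewrite !(bilin_flipE, add_lfunE, scale_lfunE).
Qed.

Lemma symmetric_bilinP m :
  reflect (forall x y, m x y = m y x) (m \in symmetric_bilin).
Proof.
rewrite memv_ker linfunE; last first.
  by move=> a u v; rewrite bilin_flip_linear scalerBr opprD addrACA.
apply: (iffP eqP) => [m0 x y | mC].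
  by apply/eqP; rewrite -subr_eq0 -[m y x]bilin_flipE -opp_lfunE -add_lfunE
    -opp_lfunE -add_lfunE m0 !zero_lfunE.
apply/lfunP => x; apply/lfunP => y.
by rewrite !(add_lfunE, opp_lfunE) bilin_flipE mC addrN !zero_lfunE.
Qed.

Lemma skew_bilinP m :
  reflect (forall x y, m x y = - m y x) (m \in skew_bilin).
Proof.
rewrite memv_ker linfunE; last first.
  by move=> a u v; rewrite bilin_flip_linear scalerDr addrACA.
apply: (iffP eqP) => [m0 x y | mC].
  by apply/eqP; rewrite -addr_eq0 -[m y x]bilin_flipE -add_lfunE
    -add_lfunE m0 !zero_lfunE.
apply/lfunP => x; apply/lfunP => y.
by rewrite !(add_lfunE, opp_lfunE) bilin_flipE mC addrN !zero_lfunE.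
Qed.

End Symmetry.

Section Laws.

Variables (k : fieldType) (W : vectType k).

Definition law : vectType k := 'Hom(W, 'End(W)).

Variant law_kind := GeneralLaws | SymmetricLaws | AlternatingLaws.

Definition laws (c : law_kind) : {vspace law} :=
  match c with
  | GeneralLaws => fullv
  | SymmetricLaws => symmetric_bilin W W
  | AlternatingLaws => skew_bilin W W
  end.

(* For such g, g^-1%VF is the inverse of g (it is only a pseudo-inverse of a
   general linear function). *)
Definition GL (g : 'End(W)) : bool := lker g == 0%VS.

Definition law_act (g : 'End(W)) (m : law) : law :=
  linfun (fun x => (g \o m (g^-1 x) \o g^-1)%VF).

(* The derivative of g |-> law_act g m at the identity, applied to xi. *)
Definition law_inf_act (xi : 'End(W)) (m : law) : law :=
  linfun (fun x => ((xi \o m x) - m (xi x) - (m x \o xi))%VF).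

Lemma law_actE g m x y :
  law_act g m x y = g (m ((g^-1)%VF x) ((g^-1)%VF y)).
Proof.
rewrite linfunE ?comp_lfunE ?comp_lfunE //.
move=> a u v; apply/lfunP => z.
by rewrite !(add_lfunE, scale_lfunE, comp_lfunE, linearP).
Qed.

Lemma law_inf_actE xi m x y :
  law_inf_act xi m x y = xi (m x y) - m (xi x) y - m x (xi y).
Proof.
rewrite linfunE; first by rewrite !(add_lfunE, opp_lfunE, comp_lfunE).
move=> a u v; apply/lfunP => z.
rewrite !(linearP, add_lfunE, opp_lfunE, scale_lfunE, comp_lfunE).
by rewrite /= !scalerDr [X in X + _ = _]addrACA [LHS]addrACA.
Qed.

End Laws.

Section Deformation.

Variables (k : fieldType) (W : vectType k) (c : law_kind).

Definition law_space : vectType k := subvs_of (laws W c).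

Local Notation A := law_space.

Definition to_law (a : A) : law W := vsval a.

(* laws W c is stable under law_act and law_inf_act, so vsproj only moves their
   values to the subtype: see GL_actE and gl_actE. *)
Definition GL_act (g : 'End(W)) (a : A) : A := vsproj (laws W c) (law_act g (to_law a)).

Definition gl_act (xi : 'End(W)) (a : A) : A :=
  vsproj (laws W c) (law_inf_act xi (to_law a)).

Lemma GL_actE g a x y :
  to_law (GL_act g a) x y = g (to_law a ((g^-1)%VF x) ((g^-1)%VF y)).
Proof.
rewrite /to_law /GL_act vsprojK ?law_actE //.
case: a => m; rewrite /to_law /=; case: (c) => //= [_|/symmetric_bilinP mC|/skew_bilinP mC].
- exact: memvf.
- by apply/symmetric_bilinP => u v; rewrite !law_actE mC.
- by apply/skew_bilinP => u v; rewrite !law_actE mC linearN.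
Qed.

Lemma gl_actE xi a x y :
  to_law (gl_act xi a) x y =
    xi (to_law a x y) - to_law a (xi x) y - to_law a x (xi y).
Proof.
rewrite /to_law /gl_act vsprojK ?law_inf_actE //.
case: a => m; rewrite /to_law /=; case: (c) => //= [_|/symmetric_bilinP mC|/skew_bilinP mC].
- exact: memvf.
- by apply/symmetric_bilinP => u v; rewrite !law_inf_actE !(mC u) !(mC _ v) addrAC.
- apply/skew_bilinP => u v; rewrite !law_inf_actE !(mC u) !(mC _ v) linearN.
  by rewrite !opprD !opprK addrAC.
Qed.

Definition GL_orbit (mu nu : A) : Prop := exists2 g, GL g & nu = GL_act g mu.

Definition bform : vectType k := 'Hom(A, 'Hom(A, k^o)).

(* Sym^2 of the dual of A, as symmetric bilinear forms (characteristic 0). *)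
Definition symmetric_forms : {vspace bform} := symmetric_bilin A k^o.

Definition bform_act (g : 'End(W)) (q : bform) : bform :=
  linfun (fun a => linfun (fun b => q (GL_act (g^-1)%VF a) (GL_act (g^-1)%VF b))).

Definition GL_stable (Q : {vspace bform}) : Prop :=
  forall g q, GL g -> q \in Q -> bform_act g q \in Q.

Lemma to_law_inj : injective to_law. Proof. exact: subvs_inj. Qed.

Lemma law_ext (a b : A) : (forall x y, to_law a x y = to_law b x y) -> a = b.
Proof.
by move=> ab; apply: to_law_inj; apply/lfunP => x; apply/lfunP => y.
Qed.

Lemma to_lawP t (a b : A) x y :
  to_law (t *: a + b) x y = t *: to_law a x y + to_law b x y.
Proof. by rewrite /to_law linearP add_lfunE scale_lfunE add_lfunE scale_lfunE. Qed.

Lemma to_lawZ t (a : A) x y : to_law (t *: a) x y = t *: to_law a x y.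
Proof. by rewrite /to_law linearZ !scale_lfunE. Qed.

Lemma GL_act_linear g : linear (GL_act g).
Proof.
move=> t a b; apply: law_ext => x y.
by rewrite to_lawP !GL_actE to_lawP linearP.
Qed.

Lemma gl_act_linear xi : linear (gl_act xi).
Proof.
move=> t a b; apply: law_ext => x y.
rewrite to_lawP !gl_actE !to_lawP linearP.
by rewrite !opprD !scalerDr !scalerN [X in X + _ = _]addrACA [LHS]addrACA.
Qed.

Lemma bform_actE g q a b :
  bform_act g q a b = q (GL_act (g^-1)%VF a) (GL_act (g^-1)%VF b).
Proof.
have fE a' : linfun (fun b => q (GL_act (g^-1)%VF a') (GL_act (g^-1)%VF b)) =1
  (fun b => q (GL_act (g^-1)%VF a') (GL_act (g^-1)%VF b)).
  by apply: linfunE => t u v; rewrite GL_act_linear linearP.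
rewrite linfunE ?fE // => t u v; apply/lfunP => w.
by rewrite add_lfunE scale_lfunE !fE GL_act_linear linearP add_lfunE scale_lfunE.
Qed.

Section InfinitesimalStability.

Variables (char0 : [pchar k] =i pred0) (Q : {vspace bform}).
Hypothesis Qstable : GL_stable Q.

Let twist (f p r : 'End(W)) (m : law W) : law W :=
  linfun (fun x => (f \o m (p x) \o r)%VF).

Let twistE f p r m x y : twist f p r m x y = f (m (p x) (r y)).
Proof.
rewrite linfunE ?comp_lfunE ?comp_lfunE // => a u v; apply/lfunP => z.
by rewrite !(add_lfunE, scale_lfunE, comp_lfunE, linearP).
Qed.

Let form2 (q : bform) (F G : 'End(A)) : bform :=
  linfun (fun a => (q (F a) \o G)%VF).

Let form2E q F G a b : form2 q F G a b = q (F a) (G b).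
Proof.
rewrite linfunE ?comp_lfunE // => t u v; apply/lfunP => z.
by rewrite !(add_lfunE, scale_lfunE, comp_lfunE, linearP).
Qed.

Let rank_one_stable (e : 'End(W)) (c0 : k) q :
    (forall x, e (e x) = c0 *: e x) -> q \in Q ->
  exists2 q', q' \in Q &
    forall a b, q' a b = q (gl_act e a) b + q a (gl_act e b).
Proof.
move=> ee qQ.
pose d : 'End(W) := (c0 *: \1 - e)%VF.
have dE x : d x = c0 *: x - e x.
  by rewrite add_lfunE opp_lfunE scale_lfunE id_lfunE.
move: d dE => d dE.
pose M (i : 'I_4) (m : law W) : law W :=
  [:: m; twist e \1%VF \1%VF m + twist \1%VF d \1%VF m + twist \1%VF \1%VF d m;
      twist e d \1%VF m + twist e \1%VF d m + twist \1%VF d d m; twist e d d m]`_i.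
have M_lin i : linear (M i).
  move=> t u v; apply/lfunP => x; apply/lfunP => y.
  case: i => [[|[|[|[|i]]]] Hi] //; rewrite /M /= !(add_lfunE, scale_lfunE) //;
    rewrite !twistE !(add_lfunE, scale_lfunE, linearP) /= ?scalerDr //.
  - by rewrite [X in X + _ = _]addrACA [LHS]addrACA.
  - by rewrite [X in X + _ = _]addrACA [LHS]addrACA.
pose N i : 'End(A) := linfun (fun a => vsproj (laws W c) (M i (to_law a))).
have NE i a : N i a = vsproj (laws W c) (M i (to_law a)).
  rewrite linfunE // => t u v.
  rewrite /to_law [vsval _]linearP M_lin. by rewrite linearP.
pose C (x : 'I_4 * 'I_4) : bform := form2 q (N x.1) (N x.2).
have r0 : 1 + c0 *: 'X != 0 :> {poly k}.
  apply/eqP => /(congr1 (fun p : {poly k} => p`_0)).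
  by rewrite coefD coefZ coefX coef1 coef0 mulr0 addr0 => /eqP; rewrite oner_eq0.
have key : \sum_(x : 'I_4 * 'I_4 | (x.1 + x.2 == 1)%N) C x \in Q.
  have H := @coef_memv k char0 bform Q ('I_4 * 'I_4)%type (fun x => (x.1 + x.2)%N) C _ 1%N r0.
  apply: H => t.
  rewrite !hornerE mulrC => u0; set u := 1 + _ in u0.
  pose h : 'End(W) := (\1 - (t / u) *: e)%VF.
  pose g : 'End(W) := (\1 + t *: e)%VF.
  have hE x : h x = x - (t / u) *: e x.
    by rewrite add_lfunE opp_lfunE scale_lfunE id_lfunE.
  have gE x : g x = x + t *: e x by rewrite add_lfunE scale_lfunE id_lfunE.
  have eL a x y : e (x + a *: y) = e x + a *: e y by rewrite linearD linearZ.
  have ghK : cancel g h.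
    move=> x; rewrite hE gE eL ee scalerA -{2}[e x]scale1r.
    rewrite -scalerDl -/u scalerA divfK // addrK //.
  have hgK : cancel h g.
    move=> x; rewrite gE hE -scaleNr eL ee scalerA.
    rewrite -addrA; set w := (X in x + X); suff -> : w = 0 by rewrite addr0.
    rewrite /w -{2}[e x]scale1r -scalerDl scalerA -scalerDl.
    suff -> : - (t / u) + t * (1 + - (t / u) * c0) = 0 by rewrite scale0r.
    by rewrite /u in u0 *; field.
  have GLh : GL h by apply/lker0P; apply: can_inj hgK.
  have hV x : (h^-1)%VF x = g x by apply: (can_inj hgK); rewrite lker0_lfunVK // ghK.
  have GLhV : lker (h^-1)%VF == 0%VS.
    by apply/lker0P => x y; rewrite !hV; apply: (can_inj ghK).
  have hVV x : ((h^-1)^-1)%VF x = h x.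
    by apply: (canLR (lker0_lfunK GLhV)); rewrite hV hgK.
  have NtE a : u ^+ 2 *: GL_act (h^-1)%VF a = \sum_(i < 4) t ^+ i *: N i a.
    rewrite -[LHS]vsvalK; under eq_bigr => i _ do rewrite NE -linearZ.
    rewrite -linear_sum; congr vsproj; apply/lfunP => x; apply/lfunP => y.
    rewrite !big_ord_recl big_ord0 addr0 /M /=.
    rewrite -/(to_law _) to_lawZ !(add_lfunE, scale_lfunE, twistE, id_lfunE) GL_actE !hVV hV.
    have uh z : u *: h z = z + t *: d z.
      rewrite hE dE scalerBr scalerA mulrCA divff // mulr1.
      by rewrite scalerDl scale1r scalerBr -scalerA addrA.
    rewrite /bump /= !add1n expr0 expr1 expr2 -scalerA scale1r.
    have -> z z' : u *: (u *: g (to_law a z z')) =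
        g (to_law a (u *: z) (u *: z')).
      have gZ s w : g (s *: w) = s *: g w by rewrite linearZ.
      have aZ s v w : to_law a v (s *: w) = s *: to_law a v w by rewrite linearZ.
      by rewrite [to_law a (_ *: _)]linearZ scale_lfunE aZ !gZ.
    have mL z v w : to_law a z (v + t *: w) =
        to_law a z v + t *: to_law a z w.
      by rewrite linearD linearZ.
    have mR z v w : to_law a (v + t *: w) z =
        to_law a v z + t *: to_law a w z.
      by rewrite linearD linearZ add_lfunE scale_lfunE.
    rewrite !uh gE mL !mR !eL !scalerDr !scalerA !addrA !exprS ?expr0 !mulr1.
    by rewrite [LHS](ACl (1*5*2*3*6*7*4*8)%AC).
  have q0Q := Qstable GLh qQ.
  suff -> : \sum_(i : 'I_4 * 'I_4) t ^+ (i.1 + i.2) *: C i = u ^+ 4 *: bform_act h q.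
    exact: memvZ.
  rewrite [LHS](_ : _ = \sum_(i < 4) \sum_(j < 4) t ^+ (i + j) *: C (i, j));
    last by rewrite pair_bigA; apply: eq_bigr => -[].
  apply/lfunP => a; apply/lfunP => b.
  rewrite !scale_lfunE bform_actE (exprD u 2 2) -scalerA.
  have qL s v w : s *: q v w = q (s *: v) w by rewrite [in RHS]linearZ scale_lfunE.
  have qR s v w : s *: q v w = q v (s *: w) by rewrite linearZ.
  have qsl (F : 'I_4 -> A) w : q (\sum_i F i) w = \sum_i q (F i) w.
    by rewrite linear_sum sum_lfunE.
  have qsr (F : 'I_4 -> A) v : q v (\sum_i F i) = \sum_i q v (F i).
    by rewrite linear_sum.
  rewrite qR qL !NtE qsl !sum_lfunE; apply: eq_bigr => i _.
  rewrite qsr !sum_lfunE; apply: eq_bigr => j _.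
  by rewrite !scale_lfunE form2E /= -qR -qL scalerA exprD mulrC.
pose o0 : 'I_4 := ord0.
pose o1 : 'I_4 := Ordinal (isT : (1 < 4)%N).
have N0 a : N o0 a = a by rewrite NE /M /= vsvalK.
have N1 a : N o1 a = gl_act e a + (c0 *+ 2) *: a.
  rewrite NE /gl_act -[X in _ + _ *: X]vsvalK -linearZ -linearD; congr vsproj.
  apply/lfunP => x; apply/lfunP => y; rewrite /M /= -/(to_law a).
  rewrite !(add_lfunE, scale_lfunE) !twistE !id_lfunE law_inf_actE !dE.
  have mL z v w : to_law a z (c0 *: v - w) = c0 *: to_law a z v - to_law a z w.
    by rewrite linearB linearZ.
  have mR z v w : to_law a (c0 *: v - w) z = c0 *: to_law a v z - to_law a w z.
    by rewrite linearB linearZ add_lfunE opp_lfunE scale_lfunE.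
  rewrite mL mR mulr2n scalerDl !addrA.
  by rewrite [LHS](ACl (1*3*5*2*4)%AC).
exists (\sum_(x : 'I_4 * 'I_4 | (x.1 + x.2 == 1)%N) C x - (c0 *+ 4) *: q).
  by rewrite memvB ?memvZ.
move=> a b.
have -> : \sum_(x : 'I_4 * 'I_4 | (x.1 + x.2 == 1)%N) C x =
    C (o0, o1) + C (o1, o0).
  rewrite (bigD1 (o0, o1)) //= (bigD1 (o1, o0)) //= big1 ?addr0 // => -[i j].
  case: i => [[|[|i]]] Hi //=; case: j => [[|[|j]]] Hj //=;
    by rewrite /eq_op /= /eq_op /= ?andbF.
rewrite !(add_lfunE, opp_lfunE, scale_lfunE) !form2E /= !N0 !N1.
have qL v w z s : q (v + s *: w) z = q v z + s * q w z.
  by rewrite linearD linearZ add_lfunE scale_lfunE.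
have qR v w z s : q z (v + s *: w) = q z v + s * q z w.
  by rewrite linearD linearZ.
rewrite qL qR -[_ *: q a b]/(_ * q a b).
move: (q a (gl_act e b) : k) (q (gl_act e a) b : k) (q a b : k) => X Y Z.
ring.
Qed.

Lemma bform_gl_act_closed (xi : 'End(W)) q : q \in Q ->
  exists2 q', q' \in Q &
    forall a b, q' a b = q (gl_act xi a) b + q a (gl_act xi b).
Proof.
move=> qQ.
pose b := vbasis (fullv : {vspace W}).
pose e i : 'End(W) := linfun (fun x => coord b i x *: xi b`_i).
have eE i x : e i x = coord b i x *: xi b`_i.
  by rewrite linfunE // => t u v; rewrite linearP scalerDl scalerA.
have ee i x : e i (e i x) = coord b i (xi b`_i) *: e i x.
  by rewrite !eE linearZ /= !scalerA mulrC.
have xiE x : xi x = \sum_i e i x.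
  rewrite {1}(coord_vbasis (memvf x)) linear_sum; apply: eq_bigr => i _.
  by rewrite eE linearZ.
have infE a : gl_act xi a = \sum_i gl_act (e i) a.
  apply: law_ext => x y; rewrite /to_law linear_sum !sum_lfunE -/(to_law _).
  rewrite (eq_bigr (fun i => e i (to_law a x y) - to_law a (e i x) y
    - to_law a x (e i y))) => [|i _]; last exact: gl_actE.
  rewrite gl_actE !xiE !sumrB; congr (_ - _ - _).
    by rewrite linear_sum sum_lfunE.
  by rewrite linear_sum.
have st i := rank_one_stable (ee i) qQ.
suff [q' q'Q q'E] : exists2 q', q' \in Q & forall v w,
    q' v w = \sum_i (q (gl_act (e i) v) w + q v (gl_act (e i) w)).
  exists q' => // v w.
  by rewrite q'E !infE linear_sum sum_lfunE linear_sum big_split.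
elim: (index_enum _) => [|i r [q1 q1Q q1E]].
  by exists 0 => [|v w]; rewrite ?mem0v // big_nil !zero_lfunE.
have [q2 q2Q q2E] := st i.
exists (q2 + q1) => [|v w]; first exact: memvD.
by rewrite !add_lfunE q1E q2E big_cons.
Qed.

End InfinitesimalStability.

Section Point.

Variables (Q : {vspace bform}).

(* The k-points of the scheme Var(Q). *)
Definition Var (nu : A) : Prop := forall q, q \in Q -> q nu nu = 0.

Definition dualQ : vectType k := 'Hom(subvs_of Q, k^o).

Definition Theta (mu nu : A) : dualQ :=
  linfun (fun q : subvs_of Q => (vsval q : bform) mu nu).

Lemma ThetaE mu nu (q : subvs_of Q) : Theta mu nu q = (vsval q : bform) mu nu.
Proof.
by rewrite linfunE // => t u v; rewrite linearP add_lfunE scale_lfunE add_lfunE scale_lfunE.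
Qed.

Variable mu : A.

Definition Phi : 'Hom(A, dualQ) := linfun (Theta mu).

Definition delta : 'Hom('End(W), A) := linfun (fun xi => gl_act xi mu).

(* ker Phi, and im delta as a subspace of it. *)
Definition Z2inc : {vspace A} := lker Phi.

Definition B2inc : {vspace subvs_of Z2inc} :=
  (linfun (vsval : subvs_of Z2inc -> A) @^-1: limg delta)%VS.

Definition H2inc : zmodType := Quotient.quot (pred_of_vspace B2inc).

Definition H3inc : zmodType := Quotient.quot (pred_of_vspace (limg Phi)).

(* Independent of the representative: see kappa2incE. *)
Definition kappa2inc (h : H2inc) : H3inc :=
  \pi_H3inc (Theta (vsval (repr h)) (vsval (repr h))).

Definition anisotropic : Prop := forall h : H2inc, kappa2inc h = 0 -> h = 0.

Lemma Theta_linear nu : linear (Theta nu).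
Proof.
by move=> t u v; apply/lfunP => q; rewrite add_lfunE scale_lfunE !ThetaE linearP.
Qed.

Lemma PhiE nu (q : subvs_of Q) : Phi nu q = (vsval q : bform) mu nu.
Proof. by rewrite linfunE ?ThetaE //; apply: Theta_linear. Qed.

Lemma deltaE xi : delta xi = gl_act xi mu.
Proof.
rewrite linfunE // => t u v; apply: law_ext => x y.
rewrite to_lawP !gl_actE !(add_lfunE, scale_lfunE).
have mL w z z' : to_law mu w (t *: z + z') = t *: to_law mu w z + to_law mu w z'.
  by rewrite linearP.
rewrite mL linearP add_lfunE scale_lfunE !opprD !scalerDr !scalerN.
by rewrite [X in X + _ = _]addrACA [LHS]addrACA.
Qed.

Section WellDefined.

Hypotheses (char0 : [pchar k] =i pred0) (Qstable : GL_stable Q).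
Hypotheses (Qsym : (Q <= symmetric_forms)%VS) (Xmu : Var mu).

Let formC (q : bform) u v : q \in Q -> q u v = q v u.
Proof. by move=> qQ; apply/symmetric_bilinP; apply: (subvP Qsym). Qed.

Lemma Phi_delta xi : Phi (delta xi) = 0.
Proof.
apply/lfunP => q; rewrite PhiE zero_lfunE deltaE.
have qQ := subvsP q.
have [q' q'Q /(_ mu mu)] := bform_gl_act_closed char0 Qstable xi qQ.
rewrite (Xmu q'Q) (formC (gl_act xi mu) _ qQ) -mulr2n => /esym/eqP.
by rewrite -mulr_natl mulf_eq0 ((pcharf0P k).1 char0) => /eqP.
Qed.

Lemma kappa2incE (a : subvs_of Z2inc) :
  kappa2inc (\pi_H2inc a) = \pi_H3inc (Theta (vsval a) (vsval a)).
Proof.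
rewrite /kappa2inc; set r := repr _.
have /eqP : \pi_H2inc r = \pi_H2inc a by rewrite reprK.
rewrite -Quotient.idealrBE -memv_preim linfunE; last first.
  by move=> t u v; rewrite linearP.
case/memv_imgP => xi _ raE.
have mixed b : b \in Z2inc -> forall q, q \in Q ->
    q b (gl_act xi mu) = - q mu (gl_act xi b).
  rewrite memv_ker => /eqP Pb q qQ.
  have [q' q'Q /(_ b mu)] := bform_gl_act_closed char0 Qstable xi qQ.
  have -> : q' b mu = 0.
    rewrite formC //; have := congr1 (fun f : dualQ => f (Subvs q'Q)) Pb.
    by rewrite PhiE zero_lfunE.
  rewrite (formC (gl_act xi b) _ qQ) => /esym/eqP.
  by rewrite addrC addr_eq0 => /eqP.
apply/eqP; rewrite -Quotient.idealrBE.
pose D := delta xi.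
have DZ : D \in Z2inc by rewrite memv_ker Phi_delta.
have -> : Theta (vsval r) (vsval r) - Theta (vsval a) (vsval a)
    = Phi (- (gl_act xi (vsval a) *+ 2) - gl_act xi D).
  have -> : vsval r = vsval a + D.
    by apply/eqP; rewrite addrC -subr_eq; apply/eqP; move: raE; rewrite linearB.
  apply/lfunP => q; rewrite add_lfunE opp_lfunE PhiE !ThetaE.
  have qQ := subvsP q; set f : bform := vsval q in qQ *.
  have DD := mixed _ DZ f qQ.
  have aD := mixed _ (subvsP a) f qQ.
  rewrite -deltaE -/D in DD aD.
  have fD u v w : f (u + v) w = f u w + f v w by rewrite linearD add_lfunE.
  have fDr u v w : f w (u + v) = f w u + f w v by rewrite linearD.
  have fNr u w : f w (- u) = - f w u by rewrite linearN.
  rewrite mulr2n !(fD, fDr, fNr) (formC D _ qQ) DD aD.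
  move: (f (vsval a) (vsval a) : k) (f mu (gl_act xi (vsval a)) : k).
  move: (f mu (gl_act xi D) : k) => X Y Z.
  ring.
exact: memv_img (memvf _).
Qed.

End WellDefined.

End Point.

End Deformation.

(* Main.v *)
Require Import Defs.
From HB Require Import structures.
From mathcomp Require Import all_boot all_order all_algebra.
From mathcomp Require Import generic_quotient ring_quotient closed_field.
From mathcomp Require Import ring boolp.
From mathcomp.multinomials Require Import mpoly.

(** Why an anisotropic smooth point has an open orbit.

Let I be the vanishing ideal of Z, a prime ideal, let d be the dimension of Z
and T its tangent space at mu; smoothness says that dim T = d.

Tangent vectors come from the group. The crucial point is that T lies in the
image of delta_mu. A tangent vector al is in the kernel of Phi_mu because the
quadrics f_q vanish on Z. Moreover, if q in Q satisfies q(mu, _) = 0, then f_q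
is an element of I singular at mu, and at a smooth point the second-order part
of such an element vanishes on T ([hessian_vanishes_on_tangent_space]):
q(al, al) = 0. As q ranges over the forms that kill the image of Phi_mu, duality
turns this into Theta(al, al) in im Phi_mu ([mem_limg_Phi]), and anisotropy
gives al in im delta_mu ([tangent_in_limg_delta]).

The orbit fills Z. The dimension theory needed here is that of algebraically
independent functions. A chain of length d of irreducible closed subsets of Z
yields d functions independent on Z ([chain_alg_indep]). Independent functions
f_1, ..., f_e on Z are coordinates for e vector fields on Z, because derivations
extend along generically algebraic extensions in characteristic 0
([derivation_extension]); so all tangent spaces of Z have dimension at least e
([alg_indep_le_tangent_dim]). Conversely, e tangent vector fields on which the
differentials of e functions are generically independent force these functions
to be independent ([alg_indep_of_jacobian]). On the orbit of mu, the
infinitesimal action and linear coordinates on T give d independent functions.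
If a function g vanished on the orbit but not on Z, adding g to them would give
d + 1 independent functions on Z ([alg_indep_cons]), contradicting dim T = d.
So the orbit is dense in Z. It lies in Z because GL(W), being irreducible,
preserves every component of Var(Q) ([component_GL_stable]).

A dense orbit is open. The orbit is first-order definable, so quantifier
elimination over the algebraically closed field k shows that membership in it
is constant on some nonempty open part of Z ([generic_truth]); by density the
constant is truth, and the translates of this open part cover the orbit
([dense_orbit_open]). *)

Set Implicit Arguments.
Unset Strict Implicit.
Unset Printing Implicit Defensive.
Import GRing.Theory.
Local Open Scope ring_scope.
Local Open Scope quotient_scope.

(** * Extending derivations in characteristic 0 *)

Section DerivationExtension.

Variable A : comNzRingType.

Definition derivation_on (F : {pred A}) (D : A -> A) : Prop :=
  {in F &, forall a b, D (a + b) = D a + D b} /\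
  {in F &, forall a b, D (a * b) = D a * b + a * D b}.

Section Adjoin.

Variables (F : subringClosed A) (x : A).

Definition adjoin : {pred A} :=
  fun y => `[< exists2 p : {poly A}, p \is a polyOver F & y = p.[x] >].

Lemma adjoinP y :
  reflect (exists2 p : {poly A}, p \is a polyOver F & y = p.[x]) (y \in adjoin).
Proof. exact: asboolP. Qed.

Lemma adjoin_subring : subring_closed adjoin.
Proof.
split=> [|a b /adjoinP[p pF ->] /adjoinP[q qF ->]
         |a b /adjoinP[p pF ->] /adjoinP[q qF ->]]; apply/adjoinP.
- by exists 1; rewrite ?rpred1 ?hornerE.
- by exists (p - q); rewrite ?rpredB ?hornerE.
- by exists (p * q); rewrite ?rpredM ?hornerM.
Qed.

HB.instance Definition _ := GRing.isSubringClosed.Build A adjoin adjoin_subring.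

Lemma adjoin_sub : {subset F <= adjoin}.
Proof. by move=> a aF; apply/adjoinP; exists a%:P; rewrite ?polyOverC ?hornerC. Qed.

Lemma adjoin_gen : x \in adjoin.
Proof. by apply/adjoinP; exists 'X; rewrite ?polyOverX ?hornerX. Qed.

End Adjoin.

Variables (F : subringClosed A) (D : A -> A).
Hypothesis Dder : derivation_on F D.

Let DD : {in F &, forall a b, D (a + b) = D a + D b} := Dder.1.
Let DM : {in F &, forall a b, D (a * b) = D a * b + a * D b} := Dder.2.

Lemma derivation0 : D 0 = 0.
Proof.
by apply: (addrI (D 0)); rewrite -DD ?rpred0 // !addr0.
Qed.

Lemma derivation1 : D 1 = 0.
Proof.
apply: (addrI (D 1)); rewrite addr0 -[in RHS](mulr1 1) DM ?rpred1 //.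
by rewrite mulr1 mul1r.
Qed.

Lemma derivation_sum (I : Type) (r : seq I) (f : I -> A) :
  (forall i, f i \in F) -> D (\sum_(i <- r) f i) = \sum_(i <- r) D (f i).
Proof.
move=> fF; elim: r => [|i r IH]; first by rewrite !big_nil derivation0.
by rewrite !big_cons DD ?IH // rpred_sum.
Qed.

(** For p.[x] in F[x], this is the value of the derivation that equals h D on F
    and sends x to w, provided that it depends only on p.[x]. *)
Let E x h w (p : {poly A}) := h * (map_poly D p).[x] + p^`().[x] * w.

Let ED x h w : {in polyOver F &, {morph E x h w : p q / p + q}}.
Proof.
move=> p q /polyOverP pF /polyOverP qF; rewrite /E.
have -> : map_poly D (p + q) = map_poly D p + map_poly D q.
  apply/polyP => i; rewrite coefD !(coef_map_id0, derivation0) // coefD.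
  exact: DD.
by rewrite derivD !hornerD mulrDr mulrDl addrACA.
Qed.

Let EM x h w : {in polyOver F &, forall p q,
  E x h w (p * q) = E x h w p * q.[x] + p.[x] * E x h w q}.
Proof.
move=> p q /polyOverP pF /polyOverP qF; rewrite /E.
have -> : map_poly D (p * q) = map_poly D p * q + p * map_poly D q.
  apply/polyP => i; rewrite coefD !coef_map_id0 ?derivation0 // !coefM.
  rewrite derivation_sum => [|j]; last by rewrite rpredM.
  rewrite -big_split; apply: eq_bigr => j _.
  by rewrite !coef_map_id0 ?derivation0 // DM.
by rewrite derivM !(hornerD, hornerM); ring.
Qed.

Let EC x h w c : E x h w c%:P = h * D c.
Proof.
rewrite /E derivC horner0 mul0r addr0; congr (_ * _).
suff -> : map_poly D c%:P = (D c)%:P by rewrite hornerC.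
apply/polyP => i; rewrite coef_map_id0 ?derivation0 // !coefC.
by case: eqP; rewrite ?derivation0.
Qed.

Hypothesis A_domain : forall a b : A, a * b = 0 -> a = 0 \/ b = 0.
Hypothesis A_char0 : forall n, n.+1%:R != 0 :> A.

(** If x is transcendental over F every w will do. Otherwise take P of minimal
    degree killing x: E must kill P, which forces P'(x) w = - h P^D(x), where P^D
    is P with D applied to its coefficients. Choosing h = P'(x), nonzero by
    minimality and characteristic 0, avoids denominators, and every other
    polynomial killing x reduces to P by pseudo-division. *)
Let E_well_defined x : exists h w, h != 0 /\
  {in polyOver F, forall p, p.[x] = 0 -> E x h w p = 0}.
Proof.
have [[P PF [P0 Px]]|tr] := pselect (exists2 P, P \is a polyOver F &
   P != 0 /\ P.[x] = 0); last first.
  exists 1, 0; split=> [|p pF px]; first exact: oner_neq0.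
  have -> : p = 0 by apply/eqP/negPn/negP => p0; apply: tr; exists p.
  rewrite /E map_poly0 deriv0 !horner0; ring.
have [N] := ubnP (size P).
elim: N => // N IH in P PF P0 Px *; rewrite ltnS => szP.
have [[P2 P2F [P20 P2x ltP2]]|minP] := pselect (exists2 P2, P2 \is a polyOver F &
    [/\ P2 != 0, P2.[x] = 0 & (size P2 < size P)%N]).
  by apply: (IH P2) => //; apply: leq_trans szP.
have {}minP p : p \is a polyOver F -> p.[x] = 0 -> (size p < size P)%N -> p = 0.
  by move=> pF px lt; apply/eqP/negPn/negP => p0; apply: minP; exists p.
have szP1 : (1 < size P)%N.
  rewrite ltnNge; apply/negP => /size1_polyC PC; move: P0 Px.
  by rewrite PC hornerC polyC_eq0 => /negPf P0 /eqP; rewrite P0.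
have lc0 : lead_coef P != 0 by rewrite lead_coef_eq0.
exists P^`().[x], (- (map_poly D P).[x]); split.
  apply/eqP => P'x.
  have P'0 : P^`() = 0 by apply: minP (polyOver_deriv PF) P'x (lt_size_deriv P0).
  have := coef_deriv P (size P).-2; rewrite P'0 coef0 prednK; last by case: (size P) szP1 => [|[]].
  rewrite -mulr_natl -[P`_ _]/(lead_coef P) => /esym /A_domain[/eqP|/eqP].
    rewrite -(prednK (_ : 0 < (size P).-1)%N) ?(negPf (A_char0 _)) //.
    by case: (size P) szP1 => [|[]].
  by rewrite (negPf lc0).
set h := P^`().[x]; set w := - _.
have EP : E x h w P = 0 by rewrite /E /w -/h; ring.
have ECM c p : c \in F -> p \is a polyOver F -> p.[x] = 0 ->
    E x h w (c%:P * p) = c * E x h w p.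
  by move=> cF pF px; rewrite EM ?polyOverC // px mulr0 add0r hornerC.
move=> p; have [M] := ubnP (size p); elim: M => // M IHM in p *.
rewrite ltnS => szp pF px.
have [lt|le] := ltnP (size p) (size P).
  by rewrite (minP p) // /E map_poly0 deriv0 !horner0; ring.
have [q [qF qx Eq qE]] : exists q, [/\ q \is a polyOver F, q.[x] = 0,
    E x h w q = 0 & q = 'X^(size p - size P) * P].
  exists ('X^(size p - size P) * P).
  by rewrite rpredM ?hornerM ?EM ?rpredX ?polyOverX // Px EP !mulr0 addr0.
have lcF r : r \is a polyOver F -> lead_coef r \in F by move/polyOverP; apply.
(* One step of pseudo-division of p by P cancels the leading terms. *)
pose p2 := (lead_coef P)%:P * p + (- lead_coef p)%:P * q.
have p2F : p2 \is a polyOver F.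
  by apply: rpredD; apply: rpredM; rewrite ?polyOverC ?rpredN ?lcF.
have p2x : p2.[x] = 0 by rewrite hornerD !hornerM px qx !mulr0 addr0.
have szp0 : (0 < size p)%N by apply: leq_trans le; apply: leq_trans szP1.
have szp2 : (size p2 < size p)%N.
  rewrite -ltnS -[X in (_ < X.+1)%N](prednK szp0) !ltnS; apply/leq_sizeP => j.
  rewrite leq_eqVlt => /predU1P[<-|lt]; rewrite coefD !coefCM qE.
    rewrite coefXnM ltnNge leq_subLR.
    have -> : (size p <= size P + (size p).-1)%N.
      by rewrite -(prednK szp0) -(prednK (ltnW szP1)) /= addSn ltnS leq_addl.
    have -> : ((size p).-1 - (size p - size P) = (size P).-1)%N.
      by rewrite -subn1 subnAC subKn // subn1.
    by rewrite /= -!/(lead_coef _); ring.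
  have szj : (size p <= j)%N by rewrite -(prednK szp0).
  rewrite nth_default // mulr0 add0r coefXnM; case: ifP => _; rewrite ?mulr0 //.
  by rewrite nth_default ?mulr0 // leq_subRL ?subnK // (leq_trans (leq_subr _ _)).
have Ep2 := IHM _ (leq_trans szp2 szp) p2F p2x.
have : lead_coef P * E x h w p = 0.
  rewrite -ECM ?lcF // -[RHS]Ep2 ED ?rpredM ?polyOverC ?rpredN ?lcF //.
  by rewrite (ECM (- lead_coef p)) ?rpredN ?lcF // Eq mulr0 addr0.
by case/A_domain => // /eqP; rewrite (negPf lc0).
Qed.

Lemma derivation_adjoin x : exists h D', [/\ h != 0,
  derivation_on (adjoin F x) D' & {in F, forall a, D' a = h * D a}].
Proof.
have [h [w [h0 wd]]] := E_well_defined x.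
have lift y : exists p, y \in adjoin F x -> p \is a polyOver F /\ y = p.[x].
  have [/adjoinP[p pF ->]|_] := boolP (y \in adjoin F x); first by exists p.
  by exists 0.
have {lift} [L LP] := choice lift.
have LE p : p \is a polyOver F -> E x h w (L p.[x]) = E x h w p.
  move=> pF; have [|LF Lx] := LP p.[x]; first by apply/adjoinP; exists p.
  apply/eqP; rewrite -subr_eq0; apply/eqP.
  have m1 : (-1)%:P \is a polyOver F by rewrite polyOverC rpredN rpred1.
  have E1 : E x h w (-1)%:P = 0.
    rewrite EC.
    suff -> : D (-1) = 0 by rewrite mulr0.
    apply: (addIr (D 1)); rewrite -DD ?rpredN ?rpred1 // addNr add0r.
    by rewrite derivation0 derivation1.
  have -> : - E x h w p = E x h w ((-1)%:P * p).
    by rewrite EM // E1 mul0r add0r hornerC mulN1r.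
  rewrite -ED ?rpredM //; apply: wd; first by rewrite rpredD ?rpredM.
  by rewrite hornerD hornerM hornerC -Lx; ring.
exists h, (fun y => E x h w (L y)); split=> //.
  by split=> _ _ /adjoinP[p pF ->] /adjoinP[q qF ->];
    rewrite -?hornerD -?hornerM !LE ?rpredD ?rpredM ?ED ?EM.
by move=> a aF; rewrite -{1}[a](hornerC _ x) LE ?polyOverC ?EC.
Qed.

End DerivationExtension.

(** A derivation D on a subring extends to any finitely generated overring
    inside a domain, after multiplication by a nonzero element h that clears
    denominators: adjoin the generators one at a time. *)
Lemma derivation_extension (A : comNzRingType) (F : subringClosed A) (D : A -> A)
    (A_domain : forall a b : A, a * b = 0 -> a = 0 \/ b = 0)
    (A_char0 : forall n, n.+1%:R != 0 :> A) (xs : seq A) :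
  derivation_on F D ->
  exists h (F' : subringClosed A) (D' : A -> A), [/\ h != 0, derivation_on F' D',
    {in F, forall a, D' a = h * D a}, {subset F <= F'} & {subset xs <= F'}].
Proof.
elim: xs F D => [|x xs IH] F D Dder.
  by exists 1, F, D; split=> //; [exact: oner_neq0 | move=> a; rewrite mul1r].
have [h [D1 [h0 D1der D1E]]] := derivation_adjoin Dder A_domain A_char0 x.
have [h' [F' [D' [h'0 D'der D'E FF' xsF']]]] := IH _ _ D1der.
exists (h' * h), F', D'; split=> //.
- by apply/eqP => /A_domain[] /eqP; rewrite ?(negPf h0) ?(negPf h'0).
- by move=> a aF; rewrite D'E ?adjoin_sub // D1E // mulrA.
- by move=> a /adjoin_sub/FF'.
- move=> y; rewrite inE => /predU1P[->|/xsF'] //; exact: FF' (adjoin_gen _ _).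
Qed.

(** * Algebraically independent functions on a closed subset *)

Lemma mpoly_alg_ind (n : nat) (R : comNzRingType) (K : {mpoly R[n]} -> Prop) :
  (forall c, K c%:MP) -> (forall i, K 'X_i) ->
  (forall p q, K p -> K q -> K (p + q)) ->
  (forall p q, K p -> K q -> K (p * q)) -> forall p, K p.
Proof.
move=> KC KX KD KM p; rewrite [p]mpolyE.
elim: (msupp p) => [|m s IH]; first by rewrite big_nil; exact: (KC 0).
rewrite big_cons; apply: (KD _ _ _ IH); rewrite -mul_mpolyC; apply: (KM _ _ (KC _)).
rewrite mpolyXE_id; elim: (index_enum _) => [|i r IHr]; first by rewrite big_nil; exact: (KC 1).
rewrite big_cons; apply: (KM _ _ _ IHr); elim: (m i) => [|j IHj]; first exact: (KC 1).
by rewrite exprS; apply: (KM).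
Qed.

Lemma mderivXU (n : nat) (R : nzRingType) (i j : 'I_n) :
  ('X_j : {mpoly R[n]})^`M(i) = (j == i)%:R.
Proof.
rewrite mderivX mnm1E; case: eqP => [->|_]; last by rewrite scale0r.
by rewrite scale1r -[X in (X - _)%MM]add0m addmK mpolyX0.
Qed.

Section AlgebraicIndependence.

Variables (k : fieldType) (V : vectType k).
Local Notation n := (\dim (fullv : {vspace V})).
Local Notation R := {mpoly k[n]}.
Implicit Types (p q g : R) (Y Z : V -> Prop).

Lemma pevalB p q v : peval (p - q) v = peval p v - peval q v.
Proof. exact: mevalB. Qed.
Lemma pevalD p q v : peval (p + q) v = peval p v + peval q v.
Proof. exact: mevalD. Qed.
Lemma pevalM p q v : peval (p * q) v = peval p v * peval q v.
Proof. exact: mevalM. Qed.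
Lemma pevalC c v : peval (c%:MP : R) v = c.
Proof. exact: mevalC. Qed.
Lemma pevalX i v : peval ('X_i : R) v = coords v i.
Proof. exact: mevalXU. Qed.
Lemma peval_sum (I : Type) (r : seq I) (P : pred I) (F : I -> R) v :
  peval (\sum_(i <- r | P i) F i) v = \sum_(i <- r | P i) peval (F i) v.
Proof. by rewrite /peval raddf_sum. Qed.

Lemma zclosed_zeros p : zclosed (fun v => peval p v = 0).
Proof. by exists (eq p) => v; split=> [? _ <-|]; last exact. Qed.

Lemma vanishing_prime Z p q : irreducible Z -> vanishing_ideal Z (p * q) ->
  vanishing_ideal Z p \/ vanishing_ideal Z q.
Proof.
move=> [_ irr] pq; have := irr _ _ (zclosed_zeros p) (zclosed_zeros q); apply.
by move=> v /pq; rewrite pevalM => /eqP; rewrite mulf_eq0 => /orP[]/eqP; auto.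
Qed.

Lemma zclosed_separate Y v : zclosed Y -> ~ Y v ->
  exists2 p, vanishing_ideal Y p & peval p v <> 0.
Proof.
move=> [S YS] Yv; apply: contrapT => noP; apply: Yv; apply/YS => p Sp.
by apply: contrapT => pv; apply: noP; exists p => // w /YS; apply.
Qed.

(** For infinite k, this says that f maps Z onto a Zariski dense subset of affine
    e-space. *)
Definition alg_indep Z (e : nat) (f : 'I_e -> R) : Prop :=
  forall P : {mpoly k[e]},
    (forall v, Z v -> P.@[fun i => peval (f i) v] = 0) -> P = 0.

Lemma alg_indep_sub Y Z e (f : 'I_e -> R) :
  zsub Y Z -> alg_indep Y f -> alg_indep Z f.
Proof. by move=> YZ Yf P Pf; apply: Yf => v /YZ; apply: Pf. Qed.

Definition fcons e (g : R) (f : 'I_e -> R) : 'I_e.+1 -> R :=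
  fun i => oapp f g (unlift ord0 i).

(** Substituting 0 for X_0 is a ring morphism congruent to the identity modulo
    X_0, so that only constants and variables need checking. *)
Lemma split_first_variable e (P : {mpoly k[e.+1]}) : exists P1,
  P = (P \mPo [tuple oapp (fun j => 'X_j) 0 (unlift ord0 i) | i < e.+1])
        \mPo [tuple 'X_(lift ord0 j) | j < e] + 'X_ord0 * P1.
Proof.
elim/mpoly_alg_ind: P => [c|i|P Q [P1 EP] [Q1 EQ]|P Q [P1 EP] [Q1 EQ]].
- by exists 0; rewrite !comp_mpolyC mulr0 addr0.
- rewrite comp_mpolyXU -tnth_nth tnth_mktuple; case: unliftP => [j ->|->] /=.
    by exists 0; rewrite comp_mpolyXU -tnth_nth tnth_mktuple mulr0 addr0.
  by exists 1; rewrite comp_mpoly0 mulr1 add0r.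
- rewrite !comp_mpolyD; move: EP EQ; set P0 := (_ \mPo _); set Q0 := (_ \mPo _).
  clearbody P0 Q0 => -> ->; exists (P1 + Q1).
  by rewrite mulrDr addrACA.
- rewrite !rmorphM /=; move: EP EQ; set P0 := (_ \mPo _); set Q0 := (_ \mPo _).
  clearbody P0 Q0 => -> ->; exists (P1 * Q0 + (P0 + 'X_ord0 * P1) * Q1).
  rewrite [LHS]mulrDr [in LHS]mulrDl -addrA [in RHS]mulrDr [in RHS]mulrA.
  by rewrite [X in _ + (_ + X) = _]mulrCA.
Qed.

(** The passage to a larger closed set gains one dimension. In a relation
    P(g, f) = 0 on Z of minimal degree, put g = 0, which is legitimate on Y:
    independence on Y makes P(0, f) the zero polynomial, so P is divisible by its
    first variable, and that factor can be removed as Z is irreducible. *)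
Lemma alg_indep_cons Y Z e (f : 'I_e -> R) g : irreducible Z -> zsub Y Z ->
    alg_indep Y f -> vanishing_ideal Y g -> ~ vanishing_ideal Z g ->
  alg_indep Z (fcons g f).
Proof.
move=> Zirr YZ Yf Yg Zg P; have [N] := ubnP (msize P).
elim: N => // N IH in P *; rewrite ltnS => szP Pfg.
have [//|P0] := eqVneq P 0.
have [P1 EP] := split_first_variable P.
move: EP; rewrite [X in X \mPo _]Yf ?comp_mpoly0 ?add0r => [EP|v Yv].
  have {}szP : (msize P1 < N)%N.
    have P10 : P1 != 0 by apply: contraNneq P0 => P10; rewrite EP P10 mulr0.
    apply: leq_trans szP; rewrite EP msizeM //; last first.
      by rewrite -msize_poly_eq0 msizeX.
    by rewrite msizeX mdeg1.
  have P1fg v : Z v -> P1.@[fun i => peval (fcons g f i) v] = 0.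
    pose q := P1 \mPo [tuple fcons g f i | i < e.+1].
    have qE w : peval q w = P1.@[fun i => peval (fcons g f i) w].
      by rewrite /peval comp_mpoly_meval; apply: meval_eq => i; rewrite tnth_mktuple.
    have : vanishing_ideal Z (g * q).
      move=> w Zw; rewrite pevalM qE -[RHS](Pfg w Zw) EP mevalM mevalXU.
      by rewrite {2}/fcons unlift_none.
    by case/(vanishing_prime Zirr) => // Zq Zv; rewrite -qE Zq.
  by rewrite EP (IH P1) ?mulr0.
rewrite comp_mpoly_meval -[RHS](Pfg v (YZ v Yv)); apply: meval_eq => i.
rewrite tnth_mktuple /fcons; case: unliftP => [j _|_] /=; first by rewrite mevalXU.
by rewrite meval0 Yg.
Qed.

(** Each strict inclusion C_i < C_(i+1) provides a function that vanishes on the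
    smaller set only, to be added to the independent functions found on C_i. *)
Lemma chain_alg_indep Z d : irreducible_chain Z d ->
  exists f : 'I_d -> R, alg_indep Z f.
Proof.
move=> [C [Cirr Cproper]].
suff H i : (i <= d)%N -> exists f : 'I_i -> R, alg_indep (C i) f.
  have [f Cf] := H d (leqnn d); exists f.
  exact: alg_indep_sub (Cirr d (leqnn d)).2 Cf.
elim: i => [|i IH] lei.
  have [[_ [[v Cv] _]] _] := Cirr 0 lei.
  exists (fun _ => 0) => P /(_ v Cv).
  by rewrite [P]nvar0_mpolyC mevalC => ->.
have [f Cf] := IH (ltnW lei); have [CC nCC] := Cproper i lei.
have [[cl _] _] := Cirr i (ltnW lei); have [[_ irr] _] := Cirr i.+1 lei.
have [v [Cv nCv]] : exists v, C i.+1 v /\ ~ C i v.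
  by apply: contrapT => no; apply: nCC => v Cv; apply: contrapT => ?; apply: no; exists v.
have [g Cg gv] := zclosed_separate cl nCv.
by exists (fcons g f); apply: alg_indep_cons irr CC Cf Cg _ => /(_ v Cv).
Qed.

End AlgebraicIndependence.

(** * Vector fields dual to independent functions *)

Section CoordinateRing.

Variables (k : fieldType) (V : vectType k) (char0 : [pchar k] =i pred0).
Local Notation n := (\dim (fullv : {vspace V})).
Local Notation R := {mpoly k[n]}.
Variables (Z : V -> Prop) (Zirr : irreducible Z).

Definition zideal : {pred R} := fun p => `[< vanishing_ideal Z p >].

Lemma zidealP p : reflect (vanishing_ideal Z p) (p \in zideal).
Proof. exact: asboolP. Qed.

Lemma zideal_closed : idealr_closed zideal.
Proof.
split=> [||a p q /zidealP pZ /zidealP qZ].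
- by apply/zidealP => v _; rewrite /peval meval0.
- apply/zidealP => Z1; have [[v Zv] _] := Zirr.
  by move/eqP: (Z1 v Zv); rewrite /peval meval1 oner_eq0.
- by apply/zidealP => v Zv; rewrite pevalD pevalM pZ // qZ // mulr0 addr0.
Qed.

Lemma zideal_prime : prime_idealr_closed zideal.
Proof.
move=> p q /zidealP /(vanishing_prime Zirr) pq.
by apply/orP; case: pq => ?; [left | right]; apply/zidealP.
Qed.

HB.instance Definition _ := isIdealr.Build R zideal zideal_closed.
HB.instance Definition _ := isPrimeIdealrClosed.Build R zideal zideal_prime.

Lemma coordinate_ring : exists (A : comNzRingType) (pi : {rmorphism R -> A}) (lift : A -> R),
  [/\ cancel lift pi, forall p, pi p = 0 <-> vanishing_ideal Z p,
      forall a b : A, a * b = 0 -> a = 0 \/ b = 0 & forall i, i.+1%:R != 0 :> A].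
Proof.
pose A : comNzRingType := {ideal_quot zideal}.
pose pi : {rmorphism R -> A} := \pi_A.
have pi_eq0 p : pi p = 0 <-> vanishing_ideal Z p.
  have E : (pi p == 0) = (p \in zideal).
    by rewrite -[p in RHS]subr0 Quotient.idealrBE -[X in _ == X](rmorph0 pi).
  by split=> [/eqP|pZ]; [rewrite E => /zidealP | apply/eqP; rewrite E; apply/zidealP].
exists A, pi, repr; split=> // [|a b /Quotient.rquot_IdomainAxiom/orP[]/eqP|i].
- exact: reprK.
- by left.
- by right.
apply/eqP; rewrite -(rmorph_nat pi) => /pi_eq0 I1.
have [[v Zv] _] := Zirr; move/eqP: (I1 v Zv).
by rewrite -mpolyC_nat pevalC ((pcharf0P k).1 char0).
Qed.

End CoordinateRing.

Section TangentFields.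

(* A stands for the coordinate ring of Z and subst for P |-> P(f). *)
Variables (k : fieldType) (n e : nat) (A : comNzRingType).
Local Notation R := {mpoly k[n]}.
Variables (pi : {rmorphism R -> A}) (lift : A -> R).
Variables (f : 'I_e -> R) (subst : {rmorphism {mpoly k[e]} -> R}).
Hypothesis liftK : cancel lift pi.
Hypothesis A_domain : forall a b : A, a * b = 0 -> a = 0 \/ b = 0.
Hypothesis A_char0 : forall i, i.+1%:R != 0 :> A.
Hypothesis substC : forall a, subst a%:MP = a%:MP.
Hypothesis substX : forall i, subst 'X_i = f i.
Hypothesis subst_inj : forall P, pi (subst P) = 0 -> P = 0.

Let sub_gens : {pred A} := fun a => `[< exists P, a = pi (subst P) >].

Let sub_gensP a : reflect (exists P, a = pi (subst P)) (a \in sub_gens).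
Proof. exact: asboolP. Qed.

Let sub_gens_closed : subring_closed sub_gens.
Proof.
split=> [|_ _ /sub_gensP[P ->] /sub_gensP[Q ->]|_ _ /sub_gensP[P ->] /sub_gensP[Q ->]];
  apply/sub_gensP.
- by exists 1; rewrite !rmorph1.
- by exists (P - Q); rewrite !rmorphB.
- by exists (P * Q); rewrite !rmorphM.
Qed.

(* The polynomial ring k[f_1, ..., f_e], inside A. *)
Let F : subringClosed A :=
  HB.pack sub_gens (GRing.isSubringClosed.Build A sub_gens sub_gens_closed).

(** The partial derivative with respect to f_j is a derivation of k[f]; a
    nonzero multiple of it extends to all of A, where it has the form
    p |-> sum_i (d p / d X_i) a_i. *)
Lemma derivation_dual_to (j : 'I_e) : exists h (a : 'I_n -> R),
  [/\ pi h != 0, forall p, pi p = 0 -> pi (\sum_i p^`M(i) * a i) = 0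
    & forall l, pi (\sum_i (f l)^`M(i) * a i) = pi (h *+ (l == j))].
Proof.
have [D DE] : exists D : A -> A, forall P, D (pi (subst P)) = pi (subst P^`M(j)).
  have : forall a, exists b, forall P, a = pi (subst P) -> b = pi (subst P^`M(j)).
    move=> a; have [/sub_gensP[P ->]|aF] := boolP (a \in sub_gens).
      exists (pi (subst P^`M(j))) => Q /eqP; rewrite -subr_eq0 -!rmorphB => /eqP/subst_inj/eqP.
      by rewrite subr_eq0 => /eqP ->.
    by exists 0 => P aP; case/sub_gensP: aF; exists P.
  by case/choice => D DE; exists D => P; apply: DE.
have Dder : derivation_on F D.
  split=> _ _ /sub_gensP[P ->] /sub_gensP[Q ->].
    by rewrite -!rmorphD !DE mderivD !rmorphD.
  by rewrite -!rmorphM !DE mderivM rmorphD !rmorphM rmorphD !rmorphM.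
have [h [F' [D' [h0 D'der D'E FF' XF']]]] := derivation_extension
  A_domain A_char0 [seq pi 'X_i | i : 'I_n] Dder.
pose a i := lift (D' (pi 'X_i)).
have D'pi p : pi p \in F' /\ D' (pi p) = pi (\sum_i p^`M(i) * a i).
  elim/mpoly_alg_ind: p => [c|i|p q [pF Dp] [qF Dq]|p q [pF Dp] [qF Dq]].
  - have cF : pi c%:MP \in F by apply/sub_gensP; exists c%:MP; rewrite substC.
    split; first exact: FF'.
    rewrite big1 ?rmorph0 => [|i _]; last by rewrite mderivC mul0r.
    by rewrite D'E // -substC DE mderivC !rmorph0 mulr0.
  - split; first by apply: XF'; apply: image_f.
    rewrite (bigD1 i) //= big1 => [|l li]; rewrite mderivXU.
      by rewrite eqxx mul1r addr0 liftK.
    by rewrite eq_sym (negPf li) mul0r.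
  - have -> : pi (p + q) = pi p + pi q by rewrite rmorphD.
    split; first exact: rpredD.
    rewrite D'der.1 // Dp Dq -rmorphD -big_split; congr (pi _).
    by apply: eq_bigr => i _; rewrite mderivD mulrDl.
  - have -> : pi (p * q) = pi p * pi q by rewrite rmorphM.
    split; first exact: rpredM.
    rewrite D'der.2 // Dp Dq -!rmorphM -rmorphD mulr_suml mulr_sumr -big_split.
    by congr (pi _); apply: eq_bigr => i _; rewrite mderivM /= mulrDl mulrAC mulrA.
exists (lift h), a; split=> [|p p0|l]; first by rewrite liftK.
  by rewrite -(D'pi p).2 p0 -(rmorph0 pi) (D'pi 0).2 big1 // => i _; rewrite mderiv0 mul0r.
rewrite -(D'pi (f l)).2 -substX D'E; last by apply/sub_gensP; exists 'X_l.
by rewrite DE mderivXU rmorphMn liftK !rmorph_nat mulr_natr.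
Qed.

End TangentFields.

Lemma tangent_field (k : fieldType) (char0 : [pchar k] =i pred0) (V : vectType k)
    (Z : V -> Prop) e (f : 'I_e -> {mpoly k[\dim (fullv : {vspace V})]}) :
    irreducible Z -> alg_indep Z f ->
  forall j, exists h (a : 'I_(\dim (fullv : {vspace V})) -> {mpoly k[_]}),
  [/\ ~ vanishing_ideal Z h,
      forall p, vanishing_ideal Z p -> vanishing_ideal Z (\sum_i p^`M(i) * a i)
    & forall l, vanishing_ideal Z (\sum_i (f l)^`M(i) * a i - h *+ (l == j))].
Proof.
move=> Zirr f_indep j.
have [A [pi [lift [liftK pi0 A_domain A_char0]]]] := coordinate_ring char0 Zirr.
pose subst : {rmorphism {mpoly k[e]} -> {mpoly k[_]}} := comp_mpoly [tuple f i | i < e].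
have [||P /pi0 P0|h [a [h0 aI af]]] :=
    @derivation_dual_to _ _ _ _ pi lift f subst liftK A_domain A_char0 _ _ _ j.
- by move=> c; apply: comp_mpolyC.
- by move=> i; rewrite /subst /= comp_mpolyXU -tnth_nth tnth_mktuple.
- apply: f_indep => v Zv; rewrite -[RHS](P0 v Zv) /peval comp_mpoly_meval.
  by apply: meval_eq => i; rewrite tnth_mktuple.
exists h, a; split=> [/pi0/eqP|p /pi0 p0|l]; first by rewrite (negPf h0).
  exact/pi0/aI.
by apply/pi0; rewrite rmorphB af subrr.
Qed.

(** * Independent functions and tangent spaces *)

Section TangentSpaces.

Variables (k : fieldType) (V : vectType k).
Local Notation n := (\dim (fullv : {vspace V})).
Local Notation R := {mpoly k[n]}.
Implicit Types (p q g h : R) (x z : V).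

Definition cvec (v : V) : 'cV[k]_n := \col_i coords v i.

Definition jac m (p : 'I_m -> R) (z : V) : 'M[k]_(m, n) :=
  \matrix_(i, j) peval ((p i)^`M(j)) z.

Lemma pdiff_jac m (p : 'I_m -> R) z v i : pdiff (p i) z v = (jac p z *m cvec v) i 0.
Proof. by rewrite mxE; apply: eq_bigr => j _; rewrite !mxE. Qed.

Lemma coordsP a (u v : V) i : coords (a *: u + v) i = a * coords u i + coords v i.
Proof. by rewrite /coords linearP. Qed.

Lemma pdiff_linear p x a u v : pdiff p x (a *: u + v) = a * pdiff p x u + pdiff p x v.
Proof.
rewrite /pdiff mulr_sumr -big_split; apply: eq_bigr => i _.
by rewrite coordsP /=; ring.
Qed.

Definition dform p x : 'Hom(V, k^o) := linfun (pdiff p x : V -> k^o).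

Lemma dformE p x v : dform p x v = pdiff p x v.
Proof. by rewrite linfunE // => a u w; apply: pdiff_linear. Qed.

Lemma pdiffM p q x v :
  pdiff (p * q) x v = pdiff p x v * peval q x + peval p x * pdiff q x v.
Proof.
rewrite /pdiff mulr_suml mulr_sumr -big_split; apply: eq_bigr => i _.
by rewrite mderivM pevalD !pevalM /=; ring.
Qed.

Lemma pdiffD p q x v : pdiff (p + q) x v = pdiff p x v + pdiff q x v.
Proof.
rewrite /pdiff -big_split; apply: eq_bigr => i _.
by rewrite mderivD pevalD mulrDl.
Qed.

Lemma pdiffC c x v : pdiff c%:MP x v = 0.
Proof. by rewrite /pdiff big1 // => i _; rewrite mderivC /peval meval0 mul0r. Qed.

Lemma pdiffX i x v : pdiff 'X_i x v = coords v i.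
Proof.
rewrite /pdiff (bigD1 i) //= big1 => [|j ji]; rewrite mderivXU.
  by rewrite eqxx /peval meval1 mul1r addr0.
by rewrite eq_sym (negPf ji) /peval meval0 mul0r.
Qed.

Lemma pdiff_sum (I : Type) (r : seq I) (F : I -> R) x v :
  pdiff (\sum_(i <- r) F i) x v = \sum_(i <- r) pdiff (F i) x v.
Proof.
rewrite /pdiff [RHS]exchange_big /=; apply: eq_bigr => i _.
by rewrite raddf_sum peval_sum mulr_suml.
Qed.

Lemma vanishing_prod (Z : V -> Prop) (I : Type) (r : seq I) (F : I -> R) :
  irreducible Z -> (forall i, ~ vanishing_ideal Z (F i)) ->
  ~ vanishing_ideal Z (\prod_(i <- r) F i).
Proof.
move=> Zirr FZ; elim: r => [|i r IH].
  rewrite big_nil => Z1; have [[v Zv] _] := Zirr.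
  by move/eqP: (Z1 v Zv); rewrite /peval meval1 oner_eq0.
by rewrite big_cons => /(vanishing_prime Zirr)[/FZ|].
Qed.

(** At a generic point z the tangent space of Z has dimension at least e: the
    columns of a are the values at z of the vector fields dual to f, independent
    because the matrix of the differentials of f on them is diagonal with
    entries that do not vanish at z. *)
Lemma generic_tangent_rank (char0 : [pchar k] =i pred0) (Z : V -> Prop) e (f : 'I_e -> R) :
    irreducible Z -> alg_indep Z f ->
  exists2 h, ~ vanishing_ideal Z h & forall z, Z z -> peval h z != 0 ->
    exists2 a : 'M[k]_(n, e), \rank a = e &
      forall m (p : 'I_m -> R), (forall i, vanishing_ideal Z (p i)) ->
        jac p z *m a = 0.
Proof.
move=> Zirr Zf; have := tangent_field char0 Zirr Zf.
case/choice => h /choice[a H].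
exists (\prod_j h j); first by apply: vanishing_prod => // j; case: (H j).
move=> z Zz; rewrite /peval rmorph_prod => /prodf_neq0 hz.
exists (\matrix_(i, j) peval (a j i) z); last first.
  move=> m p pZ; apply/matrixP => i j; rewrite !mxE.
  have [_ /(_ _ (pZ i) z Zz) pa _] := H j; rewrite -[RHS]pa peval_sum.
  by apply: eq_bigr => l _; rewrite !mxE pevalM.
apply/eqP; rewrite eqn_leq rank_leq_col /=.
set am := (\matrix_(_, _) _).
have fa : jac f z *m am = diag_mx (\row_j peval (h j) z).
  apply/matrixP => l j; rewrite !mxE; have [_ _ /(_ l z Zz)] := H j.
  rewrite pevalB peval_sum => /eqP; rewrite subr_eq0 => /eqP fh.
  rewrite (eq_bigr (fun i => peval ((f l)^`M(i) * a j i) z)) => [|i _]; last first.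
    by rewrite !mxE pevalM.
  by rewrite fh /peval raddfMn; case: eqP => // ->.
have faE : \rank (jac f z *m am) = e;
  last by rewrite -[X in (X <= _)%N]faE mxrankM_maxr.
apply: mxrank_unit; rewrite fa unitmxE det_diag unitfE.
by apply/prodf_neq0 => j _; rewrite mxE; apply: hz.
Qed.

(** Elements of I whose differentials at x cut out T in U, together with a dual
    family of vectors of U; found one at a time by choosing w in U outside T and
    an element of I whose differential does not kill w. *)
Lemma tangent_equations (Z : V -> Prop) x m (T U : {vspace V}) :
    (forall v, v \in T <-> tangent Z x v) -> (T <= U)%VS -> (m + \dim T = \dim U)%N ->
  exists (p : 'I_m -> R) (u : 'I_m -> V),
    [/\ forall i, vanishing_ideal Z (p i), forall i, u i \in U
      & forall i j, pdiff (p i) x (u j) = (i == j)%:R].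
Proof.
move=> TP; elim: m U => [|m IH] U TU dimU.
  by exists (fun _ => 0), (fun _ => 0); split=> [[]|[]|[]].
have [w wU wT] : exists2 w, w \in U & w \notin T.
  apply: contrapT => no; have : (U <= T)%VS.
    by apply/subvP => w wU; apply/negPn/negP => wT; apply: no; exists w.
  by move/dimvS; rewrite -dimU addSn ltnNge leq_addl.
have [q qZ qw] : exists2 q, vanishing_ideal Z q & pdiff q x w != 0.
  apply: contrapT => no; move/negP: wT; apply; apply/TP => q qZ.
  by apply/eqP/negPn/negP => qw; apply: no; exists q.
pose l := dform q x; have lE v : l v = pdiff q x v by exact: dformE.
pose U' := (U :&: lker l)%VS.
have TU' : (T <= U')%VS.
  apply/subvP => v vT; rewrite memv_cap (subvP TU) // memv_ker lE.
  by apply/eqP; move/TP: vT; apply.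
have dimU' : (m + \dim T = \dim U')%N.
  have := limg_ker_dim l U; rewrite -dimU.
  have -> : \dim (l @: U) = 1%N.
    apply/eqP; rewrite eqn_leq (leq_trans (dimvS (subvf _))) ?dimvf //=.
    rewrite lt0n dimv_eq0; apply: contraNneq qw => l0.
    by rewrite -lE; have := memv_img l wU; rewrite l0 memv0.
  by rewrite addn1 addSn => -[].
have [p [u [pZ uU' pu]]] := IH U' TU' dimU'.
have uU i : u i \in U by have := uU' i; rewrite memv_cap => /andP[].
have qu i : pdiff q x (u i) = 0.
  by have := uU' i; rewrite memv_cap memv_ker lE => /andP[_ /eqP].
(* Correct w so that it is killed by the equations found for the smaller U'. *)
pose w1 := w - \sum_i pdiff (p i) x w *: u i.
have pw1 i : pdiff (p i) x w1 = 0.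
  rewrite -dformE linearB linear_sum (bigD1 i) //= big1 => [|j ji]; last first.
    by rewrite linearZ /= dformE pu eq_sym (negPf ji); apply: mulr0.
  by rewrite linearZ /= !dformE pu eqxx addr0 -[_ *: _]/(_ * _) mulr1 subrr.
have qw1 : pdiff q x w1 = pdiff q x w.
  rewrite -!dformE linearB linear_sum big1 ?subr0 // => i _.
  by rewrite linearZ /= dformE qu; apply: mulr0.
have w1U : w1 \in U by rewrite memvB ?memv_suml // => i _; rewrite memvZ.
exists (fun i => oapp p q (unlift ord0 i)),
  (fun i => oapp u ((pdiff q x w)^-1 *: w1) (unlift ord0 i)).
split=> [i|i|i j]; try by case: unliftP => [j _|_] //=; rewrite memvZ.
rewrite -dformE; case: (unliftP ord0 i) => [i' ->|->]; case: (unliftP ord0 j) => [j' ->|->] /=.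
- by rewrite dformE pu (inj_eq lift_inj).
- by rewrite linearZ /= dformE pw1; apply: mulr0.
- by rewrite dformE qu.
- by rewrite linearZ /= dformE qw1; apply: mulVf.
Qed.

Lemma tangent_dim_le (Z : V -> Prop) x d : tangent_dim Z x d -> (d <= n)%N.
Proof. by case=> T _ <-; apply/dimvS/subvf. Qed.

(** The columns of N span a complement of the tangent space, on which the
    Jacobian matrix is inverted; this prepares the use of minors and of Cramer's
    rule at nearby points. *)
Lemma smooth_equations (Z : V -> Prop) x d : tangent_dim Z x d ->
  exists (p : 'I_(n - d) -> R) (N : 'M[k]_(n, n - d)),
    (forall i, vanishing_ideal Z (p i)) /\ jac p x *m N = 1%:M.
Proof.
move=> Td; have led := tangent_dim_le Td; have [T TP dimT] := Td.
have [||p [u [pZ _ pu]]] := @tangent_equations Z x (n - d) T fullv TP.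
- exact: subvf.
- by rewrite dimT subnK.
exists p, (\matrix_(i, j) coords (u j) i); split=> //.
apply/matrixP => i j; rewrite !mxE -pu; apply: eq_bigr => l _.
by rewrite !mxE.
Qed.

Definition pjac m (p : 'I_m -> R) : 'M[R]_(m, n) := \matrix_(i, j) (p i)^`M(j).

Definition ev (z : V) : {rmorphism R -> k} := [the {rmorphism R -> k} of meval (coords z)].

Lemma map_pjac m (p : 'I_m -> R) z : map_mx (ev z) (pjac p) = jac p z.
Proof. by apply/matrixP => i j; rewrite !mxE. Qed.

Lemma map_constmx m r (N : 'M[k]_(m, r)) z : map_mx (ev z) (map_mx (@mpolyC n k) N) = N.
Proof. by apply/matrixP => i j; rewrite !mxE /= mevalC. Qed.

(** A maximal minor of the Jacobian matrix, relative to the frame N of a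
    complement; being nonzero at one point of Z, it is so on a dense subset. *)
Definition minor m (p : 'I_m -> R) (N : 'M[k]_(n, m)) : R :=
  \det (pjac p *m map_mx (@mpolyC n k) N).

Lemma minorE m (p : 'I_m -> R) N z : peval (minor p N) z = \det (jac p z *m N).
Proof.
by rewrite -[LHS]/(ev z _) -det_map_mx map_mxM map_pjac map_constmx.
Qed.

Lemma minor_rank m (p : 'I_m -> R) N z : peval (minor p N) z != 0 -> \rank (jac p z) = m.
Proof.
rewrite minorE => M0; apply/eqP; rewrite eqn_leq rank_leq_row /=.
apply: leq_trans (mxrankM_maxl (jac p z) N).
by rewrite mxrank_unit // unitmxE unitfE.
Qed.

Lemma not_vanishing_point (Z : V -> Prop) p :
  ~ vanishing_ideal Z p -> exists2 z, Z z & peval p z != 0.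
Proof.
move=> pZ; apply: contrapT => no; apply: pZ => v Zv.
by apply/eqP/negPn/negP => pv; apply: no; exists v.
Qed.

(** The equations of full rank n - d at x still have rank n - d at a generic point
    z of Z, where they also kill e independent tangent vectors, so (n - d) + e <= n. *)
Lemma alg_indep_le_tangent_dim (char0 : [pchar k] =i pred0) (Z : V -> Prop) x d e
    (f : 'I_e -> R) : irreducible Z -> Z x -> tangent_dim Z x d -> alg_indep Z f ->
  (e <= d)%N.
Proof.
move=> Zirr Zx Td Zf; have led := tangent_dim_le Td.
have [p [N [pZ pN]]] := smooth_equations Td.
have [h hZ H] := generic_tangent_rank char0 Zirr Zf.
have MZ : ~ vanishing_ideal Z (minor p N).
  by move/(_ x Zx)/eqP; rewrite minorE pN det1 oner_eq0.
have [z Zz] : exists2 z, Z z & peval (minor p N * h) z != 0.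
  by apply: not_vanishing_point => /(vanishing_prime Zirr)[/MZ|/hZ].
rewrite pevalM mulf_eq0 negb_or => /andP[/minor_rank rp hz].
have [a ra pa] := H z Zz hz.
by have := mulmx0_rank_max (pa _ p pZ); rewrite rp ra -leq_subRL ?leq_subr // subKn.
Qed.

(** At a smooth point the tangent cone is the whole tangent space, here in degree
    2. Near x the tangent spaces of Z are the kernels of the Jacobian matrix J of
    n - d equations, since these kernels have dimension d and d is also a lower
    bound at generic points. Cramer's rule gives a polynomial vector field kap
    in the kernel of J with kap(x) = v. It is then tangent to Z at generic points, so
    dq(kap) vanishes on Z; differentiating dq(kap) at x in the direction v gives
    the Hessian of q at (v, v), the other term being zero as dq(x) = 0. *)
Lemma hessian_vanishes_on_tangent_space (char0 : [pchar k] =i pred0) (Z : V -> Prop) x d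
    (f : 'I_d -> R) q v :
    irreducible Z -> Z x -> tangent_dim Z x d -> alg_indep Z f ->
    vanishing_ideal Z q -> (forall i, peval q^`M(i) x = 0) -> tangent Z x v ->
  \sum_i pdiff q^`M(i) x v * coords v i = 0.
Proof.
move=> Zirr Zx Td Zf qZ dq0 vT; have led := tangent_dim_le Td.
have [p [N [pZ pN]]] := smooth_equations Td.
have [h hZ H] := generic_tangent_rank char0 Zirr Zf.
have MZ : ~ vanishing_ideal Z (minor p N).
  by move/(_ x Zx)/eqP; rewrite minorE pN det1 oner_eq0.
pose Nc := map_mx (@mpolyC n k) N; pose vc := map_mx (@mpolyC n k) (cvec v).
pose S := pjac p *m Nc.
(* kap = det(J N) v - N adj(J N) J v, which J kills by Cramer's rule. *)
pose kap : 'cV[R]_n := \det S *: vc - Nc *m (\adj S *m (pjac p *m vc)).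
have pkap : pjac p *m kap = 0.
  rewrite mulmxBr -scalemxAr mulmxA -/S mulmxA mul_mx_adj.
  by rewrite mul_scalar_mx subrr.
have kapE z : map_mx (ev z) kap =
    peval (minor p N) z *: cvec v - N *m (map_mx (ev z) (\adj S) *m (jac p z *m cvec v)).
  by rewrite map_mxB map_mxZ !map_mxM map_pjac !map_constmx.
pose g := \sum_i q^`M(i) * kap i 0.
have gZ : vanishing_ideal Z g.
  suff /(vanishing_prime Zirr)[//|/(vanishing_prime Zirr)[/MZ|/hZ]//] :
    vanishing_ideal Z (g * (minor p N * h)).
  move=> z Zz; rewrite !pevalM; apply/eqP; rewrite mulf_eq0 -implyNb; apply/implyP.
  move=> gz; rewrite mulf_eq0 -implyNb; apply/implyP => /minor_rank rp.
  apply: contraNT gz => hz; have [a ra pa] := H z Zz hz.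
  (* At z the rows of J span the annihilator of the tangent vectors a, by
     dimension; it contains dq, since q vanishes on Z. *)
  have JK : (jac p z <= kermx a)%MS by apply/sub_kermxP/pa.
  have qK : (jac (fun _ : 'I_1 => q) z <= kermx a)%MS by apply/sub_kermxP/pa.
  have KJ : (kermx a <= jac p z)%MS.
    by rewrite -(mxrank_leqif_sup JK).2 mxrank_ker ra rp.
  have /submxP[y qy] := submx_trans qK KJ.
  have : jac (fun _ : 'I_1 => q) z *m map_mx (ev z) kap = 0.
    by rewrite qy -mulmxA -map_pjac -map_mxM pkap map_mx0 mulmx0.
  move=> /(congr1 (fun M : 'M_(1, 1) => M 0 0)); rewrite !mxE => qk.
  apply/eqP; rewrite -[RHS]qk /g peval_sum; apply: eq_bigr => i _.
  by rewrite pevalM !mxE.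
have Jv : jac p x *m cvec v = 0.
  by apply/matrixP => i j; rewrite ord1 -pdiff_jac mxE; apply: vT.
have kapx i : peval (kap i 0) x = coords v i.
  have := congr1 (fun M : 'cV_n => M i 0) (kapE x).
  by rewrite Jv !mulmx0 subr0 minorE pN det1 scale1r !mxE.
rewrite -[RHS](vT g gZ) /g pdiff_sum; apply: eq_bigr => i _.
by rewrite pdiffM dq0 mul0r addr0 kapx.
Qed.

End TangentSpaces.

(** * Anisotropic points: tangent vectors are infinitesimal orbit directions *)

Section QuadraticForms.

Variables (k : fieldType) (V : vectType k).
Local Notation n := (\dim (fullv : {vspace V})).
Local Notation R := {mpoly k[n]}.
Local Notation b := (vbasis (fullv : {vspace V})).
Implicit Types (q : 'Hom(V, 'Hom(V, k^o))) (l : V -> k^o) (x v : V).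

Lemma coords_sum v : v = \sum_i coords v i *: b`_i.
Proof. exact: coord_vbasis (memvf v). Qed.

Lemma coords_inj (u v : V) : (forall i, coords u i = coords v i) -> u = v.
Proof. by move=> uv; rewrite (coords_sum u) (coords_sum v); apply: eq_bigr => i _; rewrite uv. Qed.

Definition linpoly l : R := \sum_(j < n) (l b`_j : k) *: 'X_j.

Lemma peval_linpoly l v : linear l -> peval (linpoly l) v = l v.
Proof.
move=> l_lin; rewrite -(linfunE l_lin) {2}(coords_sum v) linear_sum peval_sum.
apply: eq_bigr => j _; rewrite linearZ /= linfunE // /peval mevalZ mevalXU.
exact: mulrC.
Qed.

Lemma mderiv_linpoly l i : (linpoly l)^`M(i) = (l b`_i)%:MP.
Proof.
rewrite /linpoly raddf_sum (bigD1 i) //= big1 => [|j ji]; rewrite mderivZ mderivXU.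
  by rewrite eqxx addr0 -mul_mpolyC mulr1.
by rewrite (negPf ji) scaler0.
Qed.

Lemma pdiff_linpoly l x v : linear l -> pdiff (linpoly l) x v = l v.
Proof.
move=> l_lin; rewrite -(linfunE l_lin) [in RHS](coords_sum v) linear_sum.
apply: eq_bigr => j _; rewrite linearZ /= linfunE // mderiv_linpoly pevalC.
exact: mulrC.
Qed.

Definition qpoly q : R := \sum_(i < n) 'X_i * linpoly (q b`_i).

Let lin_left q x : linear (q^~ x : V -> k^o).
Proof. by move=> a u v; rewrite linearP add_lfunE scale_lfunE. Qed.

Let lin_right q x : linear (q x : V -> k^o).
Proof. by move=> a u v; rewrite linearP. Qed.

Lemma qsum_left q x v : q v x = \sum_(i < n) coords v i * q b`_i x.
Proof.
rewrite {1}(coords_sum v) linear_sum sum_lfunE; apply: eq_bigr => i _.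
by rewrite linearZ scale_lfunE.
Qed.

Lemma peval_qpoly q v : peval (qpoly q) v = q v v.
Proof.
rewrite qsum_left peval_sum; apply: eq_bigr => i _.
by rewrite pevalM pevalX peval_linpoly.
Qed.

Lemma mderiv_qpoly q i :
  (qpoly q)^`M(i) = linpoly (q b`_i) + linpoly (q^~ b`_i).
Proof.
rewrite /qpoly raddf_sum /= (eq_bigr (fun j => (j == i)%:R * linpoly (q b`_j) +
  (q b`_j b`_i : k) *: 'X_j)) => [|j _].
  rewrite big_split (bigD1 i) //= eqxx mul1r big1 ?addr0 // => j /negPf ->.
  by rewrite mul0r.
by rewrite mderivM mderivXU mderiv_linpoly mulrC -mul_mpolyC mulrC [_%:MP * _]mulrC.
Qed.

Lemma peval_mderiv_qpoly q i x : peval (qpoly q)^`M(i) x = q b`_i x + q x b`_i.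
Proof. by rewrite mderiv_qpoly pevalD !peval_linpoly. Qed.

Lemma pdiff_qpoly q x v : pdiff (qpoly q) x v = q v x + q x v.
Proof.
have -> : q x v = \sum_(i < n) q x b`_i * coords v i.
  rewrite {1}(coords_sum v) linear_sum; apply: eq_bigr => i _.
  by rewrite linearZ; apply: mulrC.
rewrite qsum_left -big_split; apply: eq_bigr => i _.
by rewrite peval_mderiv_qpoly mulrDl [coords _ _ * _]mulrC.
Qed.

Lemma hessian_qpoly q x v :
  \sum_i pdiff (qpoly q)^`M(i) x v * coords v i = q v v *+ 2.
Proof.
have qr : q v v = \sum_(i < n) q v b`_i * coords v i.
  rewrite {2}(coords_sum v) linear_sum; apply: eq_bigr => i _.
  by rewrite linearZ; apply: mulrC.
rewrite mulr2n {2}qr [X in X + _]qsum_left -big_split; apply: eq_bigr => i _.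
rewrite mderiv_qpoly.
by rewrite pdiffD !pdiff_linpoly // mulrDl [coords _ _ * _]mulrC.
Qed.

End QuadraticForms.

Section AnisotropicTangent.

Variables (k : fieldType) (char0 : [pchar k] =i pred0).
Variables (W : vectType k) (c : law_kind) (Q : {vspace bform W c}).
Hypotheses (Qsym : (Q <= symmetric_forms W c)%VS) (Qstable : GL_stable Q).
Variables (mu : law_space W c) (Xmu : Var Q mu).
Local Notation A := (law_space W c).

Let two_eq0 (a : k) : (a *+ 2 == 0) = (a == 0).
Proof. by rewrite -mulr_natl mulf_eq0 ((pcharf0P k).1 char0). Qed.

Let formC (q : bform W c) u v : q \in Q -> q u v = q v u.
Proof. by move=> qQ; apply/symmetric_bilinP; apply: (subvP Qsym). Qed.

(** Duality: the image of Phi_mu consists of the functionals on Q that vanish on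
    the forms q with q(mu, _) = 0. *)
Lemma mem_limg_Phi v :
    (forall q, q \in Q -> (forall w, q mu w = 0) -> q v v = 0) ->
  Theta Q v v \in limg (Phi Q mu).
Proof.
move=> Hv; pose bQ := vbasis (fullv : {vspace subvs_of Q}).
pose bA := vbasis (fullv : {vspace A}).
pose B : 'M[k]_(_, _) :=
  \matrix_(i < \dim (fullv : {vspace A}), j < \dim (fullv : {vspace subvs_of Q}))
    ((vsval bQ`_j : bform W c) mu bA`_i : k).
pose y : 'rV[k]_(_) := \row_(j < \dim (fullv : {vspace subvs_of Q}))
   ((vsval bQ`_j : bform W c) v v : k).
have /submxP[u yu] : (y <= B)%MS.
  (* A column of the cokernel of B holds the coordinates of such a form s. *)
  rewrite submxE; apply/eqP/rowP => l; rewrite !mxE.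
  pose s := \sum_j cokermx B j l *: bQ`_j.
  have sE w z : (vsval s : bform W c) w z =
      \sum_j cokermx B j l * (vsval bQ`_j : bform W c) w z.
    rewrite /s linear_sum !sum_lfunE; apply: eq_bigr => j _.
    by rewrite linearZ !scale_lfunE.
  have s0 : (vsval s : bform W c) v v = 0; last first.
    by rewrite -[RHS]s0 sE; apply: eq_bigr => j _; rewrite mxE mulrC.
  apply: Hv (subvsP s) _ => w.
  rewrite (coords_sum w) linear_sum big1 // => i _.
  rewrite linearZ /= sE; have /matrixP/(_ i l) := mulmx_coker B.
  rewrite !mxE => cokB; rewrite (eq_bigr (fun j => B i j * cokermx B j l)) => [|j _].
    by rewrite cokB; apply: mulr0.
  by rewrite [B i j]mxE mulrC.
have -> : Theta Q v v = Phi Q mu (\sum_i u 0 i *: bA`_i); last exact/memv_img/memvf.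
apply/lfunP => q; rewrite ThetaE PhiE.
rewrite [q](coord_vbasis (memvf q)) -/bQ linear_sum !sum_lfunE; apply: eq_bigr => j _.
rewrite linearZ !scale_lfunE; congr (_ *: _).
move/matrixP/(_ 0 j): yu; rewrite !mxE => ->.
by rewrite linear_sum; apply: eq_bigr => i _; rewrite linearZ /= mxE.
Qed.

Lemma anisotropic_in_B2inc v : anisotropic Q mu -> v \in Z2inc Q mu ->
  Theta Q v v \in limg (Phi Q mu) -> v \in limg (delta mu).
Proof.
move=> mu_aniso vZ vv.
have := mu_aniso (\pi_(H2inc Q mu) (Subvs vZ)).
rewrite (kappa2incE char0 Qstable Qsym Xmu) /= => H.
have /H : \pi_(H3inc Q mu) (Theta Q v v) = 0.
  have <- : \pi_(H3inc Q mu) 0 = 0 by exact: pi_zeror.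
  apply/eqP.
  by rewrite -Quotient.idealrBE subr0.
have <- : \pi_(H2inc Q mu) 0 = 0 by exact: pi_zeror.
move/eqP.
by rewrite -Quotient.idealrBE subr0 -memv_preim linfunE // => a u w; rewrite linearP.
Qed.

Lemma tangent_in_limg_delta (Z : A -> Prop) : irreducible Z -> zsub Z (Var Q) ->
    smooth_point Z mu -> anisotropic Q mu ->
  forall v, tangent Z mu v -> v \in limg (delta mu).
Proof.
move=> Zirr ZX [Zmu [d [Zchain _] Td]] mu_aniso v vT.
have [f Zf] := chain_alg_indep Zchain.
have qZ q : q \in Q -> vanishing_ideal Z (qpoly q).
  by move=> qQ z /ZX/(_ q qQ); rewrite peval_qpoly.
apply: anisotropic_in_B2inc => //.
  rewrite memv_ker; apply/eqP/lfunP => q; rewrite PhiE zero_lfunE.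
  have := vT _ (qZ _ (subvsP q)); rewrite pdiff_qpoly (formC v _ (subvsP q)).
  by rewrite -mulr2n => /eqP; rewrite two_eq0 => /eqP.
apply: mem_limg_Phi => q qQ qmu.
have := hessian_vanishes_on_tangent_space char0 Zirr Zmu Td Zf (qZ q qQ) _ vT.
rewrite hessian_qpoly => H; apply/eqP; rewrite -two_eq0; apply/eqP/H => i.
by rewrite peval_mderiv_qpoly (formC _ mu qQ) !qmu addr0.
Qed.

End AnisotropicTangent.

(** * Polynomial families of vectors *)

Section Jets.

Variables (k : fieldType) (T : Type) (t0 : T) (S : (T -> k) -> k -> Prop).

(** A class S of pairs (f, d) closed under the rules that the pairs of a
    polynomial function f and its derivative d at t0 obey. Besides these pairs it
    covers, with d left arbitrary, any subalgebra of the functions on T. *)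
Definition jet_class : Prop :=
  [/\ forall c, S (fun _ => c) 0,
      forall f d g e, S f d -> S g e -> S (fun t => f t + g t) (d + e)
    & forall f d g e, S f d -> S g e ->
        S (fun t => f t * g t) (d * g t0 + f t0 * e)].

Hypothesis S_class : jet_class.

Definition vjet (U : vectType k) (F : T -> U) (v : U) : Prop :=
  forall i, S (fun t => coords (F t) i) (coords v i).

Let SC c : S (fun _ => c) 0. Proof. by case: S_class. Qed.
Let SD f d g e : S f d -> S g e -> S (fun t => f t + g t) (d + e).
Proof. by case: S_class => _ D _; apply: D. Qed.
Let SM f d g e : S f d -> S g e -> S (fun t => f t * g t) (d * g t0 + f t0 * e).
Proof. by case: S_class => _ _; apply. Qed.

Lemma vjet_ext (U : vectType k) (F G : T -> U) u v :
  vjet F u -> F =1 G -> u = v -> vjet G v.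
Proof. by move=> FS /funext <- <-. Qed.

Lemma vjet_cst (U : vectType k) (u : U) : vjet (fun _ => u) 0.
Proof. by move=> i; rewrite {2}/coords linear0; apply: SC. Qed.

Lemma vjetD (U : vectType k) (F G : T -> U) u v :
  vjet F u -> vjet G v -> vjet (fun t => F t + G t) (u + v).
Proof.
move=> FS GS i; have := SD (FS i) (GS i).
rewrite /coords linearD; congr S; apply/funext => t; by rewrite linearD.
Qed.

Lemma vjetZ (U : vectType k) (u : U) f d :
  S f d -> vjet (fun t => f t *: u) (d *: u).
Proof.
move=> fS i; have := SM fS (SC (coords u i)).
rewrite mulr0 addr0 /coords linearZ; congr S.
by apply/funext => t; rewrite linearZ.
Qed.

Lemma vjet_scale (U : vectType k) (F : T -> U) v f d :
  S f d -> vjet F v -> vjet (fun t => f t *: F t) (d *: F t0 + f t0 *: v).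
Proof.
move=> fS FS i; have := SM fS (FS i).
rewrite /coords linearD !linearZ; congr S.
by apply/funext => t; rewrite linearZ.
Qed.

Lemma vjet_sum (U : vectType k) (I : Type) (r : seq I) (F : I -> T -> U) v :
  (forall i, vjet (F i) (v i)) ->
  vjet (fun t => \sum_(i <- r) F i t) (\sum_(i <- r) v i).
Proof.
move=> FS; elim: r => [|i r IH].
  by rewrite big_nil; apply: vjet_ext (vjet_cst 0) _ _ => // t; rewrite big_nil.
rewrite big_cons; apply: vjet_ext (vjetD (FS i) IH) _ _ => // t.
by rewrite big_cons.
Qed.

Lemma linear_coords_sum (U U' : vectType k) (L : U -> U') : linear L ->
  forall u, L u = \sum_i coords u i *: L (vbasis fullv)`_i.
Proof.
move=> L_lin u; rewrite -(linfunE L_lin) {1}(coords_sum u) linear_sum.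
by apply: eq_bigr => i _; rewrite linearZ /= linfunE.
Qed.

Lemma vjet_linear (U U' : vectType k) (L : U -> U') F v : linear L ->
  vjet F v -> vjet (fun t => L (F t)) (L v).
Proof.
move=> L_lin FS; rewrite (linear_coords_sum L_lin v).
apply: vjet_ext (vjet_sum _ (fun i => vjetZ _ (FS i))) _ _ => // t.
by rewrite [RHS](linear_coords_sum L_lin).
Qed.

(** Expanding both arguments in bases reduces this to the product rule in S. *)
Lemma vjet_bilinear (U1 U2 U3 : vectType k) (B : U1 -> U2 -> U3) F G v w :
    (forall y, linear (B^~ y)) -> (forall x, linear (B x)) ->
  vjet F v -> vjet G w ->
  vjet (fun t => B (F t) (G t)) (B v (G t0) + B (F t0) w).
Proof.
move=> Bl Br FS GS.
have BE x y : B x y = \sum_i \sum_j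
    (coords x i * coords y j) *: B (vbasis fullv)`_i (vbasis fullv)`_j.
  rewrite (linear_coords_sum (Bl y)); apply: eq_bigr => i _.
  rewrite (linear_coords_sum (Br _)) scaler_sumr; apply: eq_bigr => j _.
  by rewrite scalerA.
apply: vjet_ext
  (vjet_sum _ (fun i => vjet_sum _ (fun j => vjetZ _ (SM (FS i) (GS j))))) _ _.
  by move=> t; rewrite [RHS]BE.
rewrite !BE -big_split; apply: eq_bigr => i _; rewrite -big_split.
by apply: eq_bigr => j _; rewrite scalerDl.
Qed.

Lemma jet_peval (U : vectType k) (F : T -> U) v (P : {mpoly k[\dim (fullv : {vspace U})]}) :
  vjet F v -> S (fun t => peval P (F t)) (pdiff P (F t0) v).
Proof.
move=> FS; elim/mpoly_alg_ind: P => [c|i|p q pS qS|p q pS qS].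
- by under eq_fun do rewrite pevalC; rewrite pdiffC; apply: SC.
- by under eq_fun do rewrite pevalX; rewrite pdiffX; apply: FS.
- by under eq_fun do rewrite pevalD; rewrite pdiffD; apply: SD.
- by under eq_fun do rewrite pevalM; rewrite pdiffM; apply: SM.
Qed.

End Jets.

(** * Transport of structure *)

Section Action.

Variables (k : fieldType) (W : vectType k) (c : law_kind).
Local Notation A := (law_space W c).

Definition precomp_law (m : law W) (h h' : 'End(W)) : law W :=
  linfun (fun x => (m (h x) \o h')%VF).

Definition postcomp_law (g : 'End(W)) (m : law W) : law W :=
  linfun (fun x => (g \o m x)%VF).

Lemma precomp_lawE m h h' x y : precomp_law m h h' x y = m (h x) (h' y).
Proof.
rewrite linfunE ?comp_lfunE // => a u v; apply/lfunP => z.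
by rewrite !(add_lfunE, scale_lfunE, comp_lfunE, linearP).
Qed.

Lemma postcomp_lawE g m x y : postcomp_law g m x y = g (m x y).
Proof.
rewrite linfunE ?comp_lfunE // => a u v; apply/lfunP => z.
by rewrite !(add_lfunE, scale_lfunE, comp_lfunE, linearP).
Qed.

Lemma precomp_law_linear1 m h' : linear (precomp_law m ^~ h').
Proof.
move=> a u v; apply/lfunP => x; apply/lfunP => y.
by rewrite !(add_lfunE, scale_lfunE, precomp_lawE, linearP).
Qed.

Lemma precomp_law_linear2 m h : linear (precomp_law m h).
Proof.
move=> a u v; apply/lfunP => x; apply/lfunP => y.
by rewrite !(add_lfunE, scale_lfunE, precomp_lawE, linearP).
Qed.

Lemma postcomp_law_linear1 m : linear (postcomp_law ^~ m).
Proof.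
move=> a u v; apply/lfunP => x; apply/lfunP => y.
by rewrite !(add_lfunE, scale_lfunE, postcomp_lawE).
Qed.

Lemma postcomp_law_linear2 g : linear (postcomp_law g).
Proof.
move=> a u v; apply/lfunP => x; apply/lfunP => y.
by rewrite !(add_lfunE, scale_lfunE, postcomp_lawE, linearP).
Qed.

(** The action of g when h is its inverse. Separating the two arguments makes it
    a polynomial map, linear in g and quadratic in h. *)
Definition transport (g h : 'End(W)) (a : A) : A :=
  vsproj (laws W c) (postcomp_law g (precomp_law (to_law a) h h)).

Lemma transportE g h a x y : to_law (transport g h a) x y = g (to_law a (h x) (h y)).
Proof.
rewrite /to_law /transport vsprojK ?postcomp_lawE ?precomp_lawE //.
case: a => m; rewrite /to_law /=; case: (c) => //= [_|/symmetric_bilinP mC|/skew_bilinP mC].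
- exact: memvf.
- by apply/symmetric_bilinP => u v; rewrite !postcomp_lawE !precomp_lawE mC.
- by apply/skew_bilinP => u v; rewrite !postcomp_lawE !precomp_lawE mC linearN.
Qed.

Lemma transport_linear g h : linear (transport g h).
Proof.
move=> t a b; apply: law_ext => x y.
by rewrite to_lawP !transportE to_lawP linearP.
Qed.

Lemma transportZ s t g h a : transport (s *: g) (t *: h) a = (s * t ^+ 2) *: transport g h a.
Proof.
apply: law_ext => x y; rewrite to_lawZ !transportE !scale_lfunE.
rewrite [to_law a (t *: _)]linearZ scale_lfunE [to_law a (h x) _]linearZ /= scalerA.
by rewrite linearZ /= scalerA.
Qed.

Definition inverse_pair (g h : 'End(W)) : Prop := (g \o h = \1)%VF /\ (h \o g = \1)%VF.

Lemma inverse_pair_GL g h : inverse_pair g h -> GL g /\ (g^-1)%VF = h.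
Proof.
move=> [gh hg].
have gI : GL g.
  by apply/lker0P; apply: (can_inj (g := h)) => x; rewrite -comp_lfunE hg id_lfunE.
by split=> //; rewrite -[LHS]comp_lfun1r -gh lker0_compKf.
Qed.

Lemma GL_inverse_pair g : GL g -> inverse_pair g (g^-1)%VF.
Proof. by move=> gI; split; [apply: lker0_compfV | apply: lker0_compVf]. Qed.

Lemma GL_act_transport g a : GL_act g a = transport g (g^-1)%VF a.
Proof. by apply: law_ext => x y; rewrite GL_actE transportE. Qed.

Lemma GL_orbitP (x y : A) :
  GL_orbit x y <-> exists g h, inverse_pair g h /\ y = transport g h x.
Proof.
split=> [[g gI ->]|[g [h [/inverse_pair_GL[gI gV] ->]]]].
  by exists g, (g^-1)%VF; rewrite GL_act_transport; split=> //; apply: GL_inverse_pair.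
by exists g; rewrite // GL_act_transport gV.
Qed.

Lemma transport_comp g g' h h' a :
  transport g g' (transport h h' a) = transport (g \o h) (h' \o g') a.
Proof. by apply: law_ext => x y; rewrite !transportE !comp_lfunE. Qed.

Lemma inverse_pair_comp g g' h h' :
  inverse_pair g g' -> inverse_pair h h' -> inverse_pair (g \o h) (h' \o g').
Proof.
move=> [gg' g'g] [hh' h'h]; split.
  by rewrite comp_lfunA -(comp_lfunA g) hh' comp_lfun1r.
by rewrite comp_lfunA -(comp_lfunA h') g'g comp_lfun1r.
Qed.

Lemma transport1 a : transport \1 \1 a = a.
Proof. by apply: law_ext => x y; rewrite transportE !id_lfunE. Qed.

Lemma inverse_pair1 : inverse_pair \1 \1.
Proof. by split; rewrite comp_lfun1l. Qed.

Lemma GL_orbit_refl (x : A) : GL_orbit x x.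
Proof.
apply/GL_orbitP; exists \1%VF, \1%VF.
by rewrite transport1; split=> //; apply: inverse_pair1.
Qed.

Lemma GL_orbit_trans (x y z : A) : GL_orbit x y -> GL_orbit y z -> GL_orbit x z.
Proof.
move=> /GL_orbitP[h [h' [hh' ->]]] /GL_orbitP[g [g' [gg' ->]]]; apply/GL_orbitP.
by exists (g \o h)%VF, (h' \o g')%VF; rewrite transport_comp; split=> //; apply: inverse_pair_comp.
Qed.

Lemma GL_orbit_sym (x y : A) : GL_orbit x y -> GL_orbit y x.
Proof.
move=> /GL_orbitP[g [h [[gh hg] ->]]]; apply/GL_orbitP.
by exists h, g; rewrite transport_comp hg transport1.
Qed.

Section TransportJet.

Variables (T : Type) (t0 : T) (S : (T -> k) -> k -> Prop).
Hypothesis S_class : jet_class t0 S.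

Lemma vjet_transport (G H : T -> 'End(W)) g' h' a :
  vjet S G g' -> vjet S H h' ->
  vjet S (fun t => transport (G t) (H t) a)
    (vsproj (laws W c) (postcomp_law g' (precomp_law (to_law a) (H t0) (H t0)) +
      postcomp_law (G t0) (precomp_law (to_law a) h' (H t0) +
                           precomp_law (to_law a) (H t0) h'))).
Proof.
move=> GS HS; apply: (vjet_linear S_class (L := vsproj (laws W c))).
  by move=> s u v; rewrite linearP.
apply: (vjet_bilinear S_class postcomp_law_linear1 postcomp_law_linear2) => //.
exact: (vjet_bilinear S_class (precomp_law_linear1 _) (precomp_law_linear2 _)).
Qed.

End TransportJet.

End Action.

(** * Polynomial curves in orbits *)

Section Curves.

Variables (k : fieldType) (char0 : [pchar k] =i pred0).

Definition poly_curve (f : k -> k) (d : k) : Prop :=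
  exists p : {poly k}, (forall t, f t = p.[t]) /\ d = p^`().[0].

Lemma poly_curve_class : jet_class 0 poly_curve.
Proof.
split=> [a|f d g e [p [fp ->]] [q [gq ->]]|f d g e [p [fp ->]] [q [gq ->]]].
- by exists a%:P; split=> [t|]; rewrite ?derivC ?hornerC.
- by exists (p + q); split=> [t|]; rewrite ?derivD hornerD ?fp ?gq.
- by exists (p * q); split=> [t|]; rewrite ?derivM ?hornerD !hornerM ?fp ?gq.
Qed.

Lemma poly_curve_horner p : poly_curve (horner p) p^`().[0].
Proof. by exists p. Qed.

Lemma poly_curve_unique f d e : poly_curve f d -> poly_curve f e -> d = e.
Proof.
move=> [p [fp ->]] [q [fq ->]]; congr (_^`().[_]); apply/eqP.
rewrite -subr_eq0; apply/eqP/(poly_fun_eq0 char0) => t.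
by rewrite hornerD hornerN -fp -fq subrr.
Qed.

Lemma vpoly_curve_unique (U : vectType k) (F : k -> U) u v :
  vjet poly_curve F u -> vjet poly_curve F v -> u = v.
Proof.
move=> Fu Fv; rewrite (coords_sum u) (coords_sum v); apply: eq_bigr => i _.
by rewrite (poly_curve_unique (Fu i) (Fv i)).
Qed.

Variables (W : vectType k) (c : law_kind).
Local Notation A := (law_space W c).

(** Products are reversed because matrices act on row vectors. *)
Lemma End_matrix_model : exists N (hom : {linear 'M[k]_N -> 'End(W)})
    (mx : {linear 'End(W) -> 'M[k]_N}),
  [/\ cancel mx hom, forall X Y, hom (X *m Y) = (hom Y \o hom X)%VF,
      hom 1%:M = \1%VF, mx \1%VF = 1%:M & forall g h, mx (g \o h)%VF = mx h *m mx g].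
Proof.
pose N := \dim (fullv : {vspace W}); pose e := vbasis (fullv : {vspace W}).
have e_basis : basis_of fullv e := vbasisP _.
have hom_lin : linear (passmx.hommx e e : 'M[k]_N -> 'End(W)).
  exact: passmx.hommx_linear.
have mx_lin : linear (passmx.mxof e e : 'End(W) -> 'M[k]_N).
  exact: passmx.mxof_linear.
exists N, (HB.pack_for {linear 'M[k]_N -> 'End(W)} (passmx.hommx e e : 'M[k]_N -> 'End(W))
    (GRing.isLinear.Build k _ _ *:%R _ hom_lin)),
  (HB.pack_for {linear 'End(W) -> 'M[k]_N} (passmx.mxof e e : 'End(W) -> 'M[k]_N)
    (GRing.isLinear.Build k _ _ *:%R _ mx_lin)); split=> /=.
- exact: passmx.mxofK.
- by move=> X Y; apply: passmx.hommx_mul.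
- exact: passmx.hommx1.
- exact (passmx.mxof1 (basis_free e_basis)).
- by move=> g h; apply: passmx.mxof_comp.
Qed.

Definition line (g0 g1 : 'End(W)) (t : k) : 'End(W) := g0 + t *: g1.

Lemma line_jet g0 g1 : vjet poly_curve (line g0 g1) g1.
Proof.
have tX : poly_curve (fun t => t) 1.
  by exists 'X; split=> [t|]; rewrite ?derivX ?hornerX ?hornerC.
have := vjetD poly_curve_class (vjet_cst poly_curve_class g0) (vjetZ poly_curve_class g1 tX).
by rewrite add0r scale1r.
Qed.

(** The adjugate K of the line g0 + t g1 is a polynomial inverse up to the
    determinant w. *)
Lemma line_adjugate g0 g1 : exists (w : {poly k}) (K : k -> 'End(W)) (K' : 'End(W)),
  [/\ vjet poly_curve K K',
      forall t, (line g0 g1 t \o K t = w.[t] *: \1)%VF,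
      forall t, (K t \o line g0 g1 t = w.[t] *: \1)%VF
    & forall t, GL (line g0 g1 t) -> w.[t] != 0].
Proof.
have [N [hom [mx [mxK homM hom1 mx1 mxM]]]] := End_matrix_model.
have hom_scalar a : hom a%:M = (a *: \1)%VF by rewrite -scalemx1 linearZ hom1.
pose M : 'M[{poly k}]_N := map_mx polyC (mx g0) + 'X *: map_mx polyC (mx g1).
have mx_line t : map_mx (horner_eval t) M = mx (line g0 g1 t).
  by apply/matrixP => i j; rewrite linearD linearZ !mxE /= /horner_eval !hornerE.
have ME t : hom (map_mx (horner_eval t) M) = line g0 g1 t by rewrite mx_line mxK.
have MK t : map_mx (horner_eval t) (\adj M) *m map_mx (horner_eval t) M = ((\det M).[t])%:M.
  by rewrite -map_mxM mul_adj_mx map_scalar_mx.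
have KM t : map_mx (horner_eval t) M *m map_mx (horner_eval t) (\adj M) = ((\det M).[t])%:M.
  by rewrite -map_mxM mul_mx_adj map_scalar_mx.
exists (\det M), (fun t => hom (map_mx (horner_eval t) (\adj M))),
  (\sum_i \sum_j ((\adj M) i j)^`().[0] *: hom (delta_mx i j)).
split=> [|t|t|t gI].
- apply: vjet_ext (vjet_sum poly_curve_class _ (fun i => vjet_sum poly_curve_class _
    (fun j => vjetZ poly_curve_class _ (poly_curve_horner ((\adj M) i j))))) _ _ => // t.
  rewrite [in RHS](matrix_sum_delta (map_mx _ _)) linear_sum; apply: eq_bigr => i _.
  by rewrite linear_sum; apply: eq_bigr => j _; rewrite linearZ !mxE.
- by rewrite -ME -homM MK hom_scalar.
- by rewrite -ME -homM KM hom_scalar.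
have [gh _] := GL_inverse_pair gI.
move/(congr1 mx): gh; rewrite mxM mx1 -mx_line => /(congr1 determinant).
rewrite det_mulmx det1 det_map_mx /= /horner_eval => H; apply/eqP => w0.
by move/eqP: H; rewrite w0 mulr0 eq_sym oner_eq0.
Qed.

(** Inverses are only needed up to scalars: as s in k acts on laws by s^-1, the
    orbit is stable under nonzero scalars, which absorb s w^2. *)
Lemma GL_orbit_adjugate (x : A) g h w s : w != 0 -> s != 0 ->
    (g \o h = w *: \1)%VF -> (h \o g = w *: \1)%VF ->
  GL_orbit x (transport (s *: g) h x).
Proof.
move=> w0 s0 gh hg; apply/GL_orbitP; pose r := (s * w ^+ 2)^-1.
have r0 : r != 0 by rewrite invr_eq0 mulf_neq0 // expf_neq0.
exists (r *: g), ((r * w)^-1 *: h); split.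
  split; rewrite -comp_lfunZl -comp_lfunZr ?gh ?hg !scalerA.
    by rewrite (_ : _ * _ = 1) ?scale1r //; field; rewrite r0 w0.
  by rewrite (_ : _ * _ = 1) ?scale1r //; field; rewrite r0 w0.
rewrite transportZ -[h in LHS]scale1r transportZ; congr (_ *: _).
by rewrite /r; field; rewrite w0 s0 oner_eq0.
Qed.

Lemma orbit_curve (x : A) g0 g1 : GL g0 -> exists (w : {poly k}) (K : k -> 'End(W)) (K' : 'End(W)),
  [/\ vjet poly_curve K K', w.[0] != 0,
      forall t, (line g0 g1 t \o K t = w.[t] *: \1)%VF,
      (forall t, GL (line g0 g1 t) -> w.[t] != 0) &
      forall (s : {poly k}), s.[0] != 0 -> exists r : {poly k}, r != 0 /\
       forall t, r.[t] != 0 -> GL_orbit x (transport (s.[t] *: line g0 g1 t) (K t) x)].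
Proof.
move=> g0I; have [w [K [K' [Kc gK Kg wI]]]] := line_adjugate g0 g1.
have w0 : w.[0] != 0 by apply: wI; rewrite /line scale0r addr0.
exists w, K, K'; split=> // s s0; exists (w * s); split.
  apply: contraNneq w0 => /(congr1 (horner^~ 0))/eqP.
  by rewrite hornerM horner0 mulf_eq0 (negPf s0) orbF.
move=> t; rewrite hornerM mulf_eq0 negb_or => /andP[wt st].
exact: GL_orbit_adjugate wt st (gK t) (Kg t).
Qed.

(** The line from g0 to g1 moves x along a polynomial curve in its orbit, off the
    zeros of r. The factor w^2 that the adjugate introduces is compensated by a
    scalar s that interpolates w(0)^-2 and w(1)^-2. *)
Lemma orbit_path (x y z : A) : GL_orbit x y -> GL_orbit x z ->
  exists (gam : k -> A) v (r : {poly k}), [/\ vjet poly_curve gam v, gam 0 = y, gam 1 = z, r != 0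
    & forall t, r.[t] != 0 -> GL_orbit x (gam t)].
Proof.
move=> [g0 g0I ->] [g1 g1I ->].
have [w [K [K' [Kc w0 gK wI H]]]] := orbit_curve x (g1 - g0) g0I.
have l0 : line g0 (g1 - g0) 0 = g0 by rewrite /line scale0r addr0.
have l1 : line g0 (g1 - g0) 1 = g1 by rewrite /line scale1r addrC subrK.
have w1 : w.[1] != 0 by apply: wI; rewrite l1.
pose a := w.[0] ^- 2; pose b := w.[1] ^- 2.
pose s : {poly k} := a%:P + (b - a) *: 'X.
have sE t : s.[t] = a + (b - a) * t by rewrite !hornerE.
have s0 : s.[0] = a by rewrite sE mulr0 addr0.
have s1 : s.[1] = b by rewrite sE mulr1 addrC subrK.
have [|r [r0 rH]] := H s; first by rewrite s0 invr_eq0 expf_neq0.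
have KE g t : GL g -> line g0 (g1 - g0) t = g -> K t = w.[t] *: (g^-1)%VF.
  move=> gI lt; have := gK t; rewrite lt => /(congr1 (fun f => (g^-1)%VF \o f)%VF).
  by rewrite comp_lfunA lker0_compVf // comp_lfun1l -comp_lfunZr comp_lfun1r.
pose gam t := transport (s.[t] *: line g0 (g1 - g0) t) (K t) x.
have [v gamc] : exists v, vjet poly_curve gam v.
  eexists; apply: (vjet_transport poly_curve_class _ _ Kc).
  exact: (vjet_scale poly_curve_class (poly_curve_horner s) (line_jet g0 (g1 - g0))).
exists gam, v, r; split=> //; rewrite /gam.
- rewrite (KE g0) // l0 s0 transportZ -GL_act_transport /a mulVf ?scale1r //.
  by rewrite expf_neq0.
- rewrite (KE g1) // l1 s1 transportZ -GL_act_transport /b mulVf ?scale1r //.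
  by rewrite expf_neq0.
Qed.

(** A curve in the orbit with velocity gl_act xi x. Differentiating
    (1 + t xi) K = w at 0 gives K' = w'(0) - w(0) xi; the scalar s is chosen so
    that the multiples of x in the velocity cancel. *)
Lemma orbit_tangent_curve (x : A) xi :
  exists (gam : k -> A) (r : {poly k}), [/\ vjet poly_curve gam (gl_act xi x), gam 0 = x, r != 0
    & forall t, r.[t] != 0 -> GL_orbit x (gam t)].
Proof.
have GL1 : GL (\1%VF : 'End(W)) by apply/lker0P => u v; rewrite !id_lfunE.
have [w [K [K' [Kc w0 gK wI H]]]] := orbit_curve x xi GL1.
have l0 : line \1 xi 0 = \1%VF by rewrite /line scale0r addr0.
have K0 : K 0 = w.[0] *: \1%VF.
  by have := gK 0; rewrite l0 comp_lfun1l.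
pose a := w.[0]; pose a' := w^`().[0].
have KD : K' = a' *: \1%VF - a *: xi.
  have lin1 (h : 'End(W)) : linear (fun g : 'End(W) => (g \o h)%VF).
    by move=> s u v; rewrite comp_lfunDl -comp_lfunZl.
  have lin2 (g : 'End(W)) : linear (fun h : 'End(W) => (g \o h)%VF).
    by move=> s u v; rewrite comp_lfunDr -comp_lfunZr.
  have := vjet_bilinear poly_curve_class (B := fun g h : 'End(W) => (g \o h)%VF) lin1 lin2
    (line_jet \1%VF xi) Kc.
  rewrite K0 l0 comp_lfun1l -comp_lfunZr comp_lfun1r => H1.
  have H2 : vjet poly_curve (fun t => (line \1 xi t \o K t)%VF) (a' *: \1%VF).
    by apply: vjet_ext (vjetZ poly_curve_class _ (poly_curve_horner w)) _ _.
  by rewrite (vpoly_curve_unique H2 H1) addrC addKr.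
(* s(0) = a^-2 makes the curve start at x; s'(0) cancels the term 2 a' / a
   that K' contributes to the velocity. *)
pose s : {poly k} := (a ^- 2)%:P - (2%:R * a' / a ^+ 3) *: 'X.
have s0 : s.[0] = a ^- 2.
  by rewrite hornerD hornerN hornerC hornerZ hornerX mulr0 subr0.
have s'0 : s^`().[0] = - (2%:R * a' / a ^+ 3).
  by rewrite derivB derivC derivZ derivX hornerD hornerN hornerC hornerZ hornerC mulr1 sub0r.
have [|r [r0 rH]] := H s; first by rewrite s0 invr_eq0 expf_neq0.
exists (fun t => transport (s.[t] *: line \1%VF xi t) (K t) x), r; split=> //; last first.
  by rewrite l0 K0 s0 transportZ transport1 mulVf ?scale1r // expf_neq0.
have gc := vjet_scale poly_curve_class (poly_curve_horner s) (line_jet \1%VF xi).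
apply: vjet_ext (vjet_transport poly_curve_class x gc Kc) _ _ => //.
congr vsproj; apply/lfunP => y; apply/lfunP => z.
rewrite law_inf_actE !(add_lfunE, postcomp_lawE, precomp_lawE) l0 K0 KD s'0 s0.
rewrite !(add_lfunE, scale_lfunE, opp_lfunE, id_lfunE).
move: (to_law x) => m.
have mZl b u v : m (b *: u) v = b *: m u v by rewrite linearZ scale_lfunE.
have mBl u u' v : m (u - u') v = m u v - m u' v by rewrite linearB add_lfunE opp_lfunE.
rewrite -/a !(mZl, mBl) !(linearB, linearZ) /= ?(mZl, mBl).
apply: coords_inj => i; rewrite /coords !(linearD, linearB, linearZ) /=.
by field.
Qed.

(** Orbits are irreducible: points where p and q are nonzero are joined by a
    polynomial curve, on which p q has finitely many zeros. *)
Lemma orbit_vanishing_prime (x : A) p q : vanishing_ideal (GL_orbit x) (p * q) ->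
  vanishing_ideal (GL_orbit x) p \/ vanishing_ideal (GL_orbit x) q.
Proof.
move=> pq; have [?|np] := pselect (vanishing_ideal (GL_orbit x) p); [by left | right].
apply: contrapT => nq.
have [y xy py] := not_vanishing_point np; have [z xz qz] := not_vanishing_point nq.
have [gam [v [r [gc g0 g1 r0 rH]]]] := orbit_path xy xz.
have [u [uE _]] := jet_peval poly_curve_class p gc.
have [w [wE _]] := jet_peval poly_curve_class q gc.
have : u * w * r = 0.
  apply: (poly_fun_eq0 char0) => t; rewrite !hornerM -uE -wE.
  have [->|rt] := eqVneq r.[t] 0; first by rewrite mulr0.
  by rewrite -pevalM (pq _ (rH t rt)) mul0r.
move/eqP; rewrite !mulf_eq0 (negPf r0) orbF => /orP[]/eqP z0.
  by move: py; rewrite -g0 uE z0 horner0 eqxx.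
by move: qz; rewrite -g1 wE z0 horner0 eqxx.
Qed.

Lemma orbit_tangent (x y : A) p xi : GL_orbit x y ->
  vanishing_ideal (GL_orbit x) p -> pdiff p y (gl_act xi y) = 0.
Proof.
move=> xy px; have [gam [r [gc g0 r0 rH]]] := orbit_tangent_curve y xi.
have [u [uE]] := jet_peval poly_curve_class p gc; rewrite g0 => ->.
suff -> : u = 0 by rewrite deriv0 horner0.
have /eqP : u * r = 0.
  apply: (poly_fun_eq0 char0) => t; rewrite !hornerM -uE.
  have [->|rt] := eqVneq r.[t] 0; first by rewrite mulr0.
  by rewrite px ?mul0r //; apply: GL_orbit_trans xy (rH t rt).
by rewrite mulf_eq0 (negPf r0) orbF => /eqP.
Qed.

End Curves.

(** * The Jacobian criterion for algebraic independence *)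

Lemma msize_mderiv_lt (n : nat) (R : nzRingType) (p : {mpoly R[n]}) i :
  p != 0 -> (msize p^`M(i) < msize p)%N.
Proof.
move=> p0; rewrite [msize p^`M(i)]msizeE big_tnth.
rewrite -[X in (_ < X)%N]prednK ?lt0n ?msize_poly_eq0 // ltnS.
apply/bigmax_leqP => j _; set m := tnth _ _.
have : m \in msupp p^`M(i) by apply: mem_tnth.
rewrite mcoeff_msupp mcoeff_deriv => pm.
have : (m + U_(i))%MM \in msupp p.
  by rewrite mcoeff_msupp; apply: contraNneq pm => ->; rewrite mul0rn.
move/msize_mdeg_lt; rewrite mdegD mdeg1 addn1 => lt.
by rewrite -ltnS prednK // (leq_trans _ lt).
Qed.

Lemma mderiv_eq0_const (n : nat) (R : idomainType) (p : {mpoly R[n]}) :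
    (forall i, i.+1%:R != 0 :> R) -> (forall i, p^`M(i) = 0) -> p = (p@_0)%:MP.
Proof.
move=> R_char0 dp; apply/mpolyP => m; rewrite mcoeffC.
have [->|m0] := eqVneq m 0%MM; first by rewrite mulr1.
rewrite mulr0; have [i mi] : exists i, m i != 0%N.
  by apply/existsP; apply: contraNT m0 => /existsPn mi; apply/eqP/mnmP => i;
    rewrite mnm0E; apply/eqP; have := mi i; rewrite negbK.
have lei : (U_(i) <= m)%MM by apply/mnm_lepP => j; rewrite mnm1E; case: eqP => // <-; rewrite lt0n.
have := congr1 (mcoeff (m - U_(i))%MM) (dp i); rewrite mcoeff_deriv mcoeff0 submK //.
by rewrite -mulr_natr => /eqP; rewrite mulf_eq0 (negPf (R_char0 _)) orbF => /eqP.
Qed.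

Section JacobianCriterion.

Variables (k : fieldType) (char0 : [pchar k] =i pred0) (V : vectType k).
Local Notation n := (\dim (fullv : {vspace V})).
Local Notation R := {mpoly k[n]}.

Lemma peval_comp e (P : {mpoly k[e]}) (f : 'I_e -> R) x :
  peval (P \mPo [tuple f i | i < e]) x = P.@[fun j => peval (f j) x].
Proof. by rewrite /peval comp_mpoly_meval; apply: meval_eq => i; rewrite tnth_mktuple. Qed.

Lemma pdiff_comp e (P : {mpoly k[e]}) (f : 'I_e -> R) x v :
  pdiff (P \mPo [tuple f i | i < e]) x v =
  \sum_i P^`M(i).@[fun j => peval (f j) x] * pdiff (f i) x v.
Proof.
elim/mpoly_alg_ind: P => [c|i|p q IHp IHq|p q IHp IHq].
- rewrite comp_mpolyC pdiffC big1 // => i _.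
  by rewrite mderivC meval0 mul0r.
- rewrite comp_mpolyXU -tnth_nth tnth_mktuple (bigD1 i) //= big1 => [|j ji].
    by rewrite mderivXU eqxx meval1 mul1r addr0.
  by rewrite mderivXU eq_sym (negPf ji) meval0 mul0r.
- rewrite comp_mpolyD pdiffD IHp IHq -big_split; apply: eq_bigr => i _.
  by rewrite mderivD mevalD mulrDl.
- rewrite rmorphM /= pdiffM IHp IHq !peval_comp mulr_suml mulr_sumr -big_split.
  by apply: eq_bigr => i _; rewrite mderivM mevalD !mevalM /=; ring.
Qed.

(** Take a relation P(f) = 0 on O. Applying the vector fields X_j, tangent to O,
    yields the linear system sum_i (d_i P)(f) X_j(f_i) = 0, whose determinant is
    not identically zero on O. Hence the d_i P, of smaller degree, are also
    relations, so they are zero by induction; P is constant, thus zero. *)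
Lemma alg_indep_of_jacobian (O : V -> Prop) (x0 : V) e (f : 'I_e -> R)
    (X : 'I_e -> V -> V) (Delta : 'I_e -> 'I_e -> R) :
    (forall p q, vanishing_ideal O (p * q) -> vanishing_ideal O p \/ vanishing_ideal O q) ->
    (forall p j x, vanishing_ideal O p -> O x -> pdiff p x (X j x) = 0) ->
    (forall i j x, peval (Delta i j) x = pdiff (f i) x (X j x)) ->
    O x0 -> \det (\matrix_(i, j) peval (Delta i j) x0) != 0 ->
  alg_indep O f.
Proof.
move=> O_prime OX DeltaE Ox0 det0 P; have [N] := ubnP (msize P).
elim: N => // N IH in P *; rewrite ltnS => szP Pf.
have [//|P0] := eqVneq P 0.
pose D : 'M[R]_e := \matrix_(i, j) Delta i j.
have DE x : map_mx (ev x) D = \matrix_(i, j) peval (Delta i j) x.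
  by apply/matrixP => i j; rewrite !mxE.
have dP i : P^`M(i) = 0.
  apply: IH; first by apply: leq_trans szP; apply: msize_mderiv_lt.
  have : vanishing_ideal O (\det D * (P^`M(i) \mPo [tuple f j | j < e])).
    move=> x Ox; rewrite pevalM peval_comp.
    pose r : 'rV[k]_e := \row_l P^`M(l).@[fun j => peval (f j) x].
    have rD : r *m map_mx (ev x) D = 0.
      apply/rowP => j; rewrite !mxE.
      have PO : vanishing_ideal O (P \mPo [tuple f j | j < e]).
        by move=> z Oz; rewrite peval_comp Pf.
      rewrite -[RHS](OX _ j x PO Ox) pdiff_comp; apply: eq_bigr => l _.
      by rewrite !mxE [ev x _]DeltaE.
    have : r *m (map_mx (ev x) D *m \adj (map_mx (ev x) D)) = 0 by rewrite mulmxA rD mul0mx.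
    rewrite mul_mx_adj det_map_mx mul_mx_scalar => /rowP/(_ i).
    by rewrite !mxE.
  case/O_prime => [/(_ x0 Ox0)|H x Ox]; last by rewrite -peval_comp H.
  by move/eqP: det0; rewrite -DE det_map_mx.
have := Pf x0 Ox0; rewrite (mderiv_eq0_const _ dP) => [|i]; last by rewrite ((pcharf0P k).1 char0).
by rewrite mevalC => ->.
Qed.

End JacobianCriterion.

(** * The orbit inside its component *)

Section OrbitInComponent.

Variables (k : fieldType) (char0 : [pchar k] =i pred0).
Variables (W : vectType k) (c : law_kind) (Q : {vspace bform W c}).
Local Notation A := (law_space W c).
Local Notation n := (\dim (fullv : {vspace A})).
Local Notation R := {mpoly k[n]}.
Hypothesis (Qstable : GL_stable Q).

(** The linear coordinates on T are independent on the orbit: with b_j = xi_j mu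
    the matrix of their derivatives along the fields v |-> xi_j v is the identity
    at mu. *)
Lemma alg_indep_orbit (mu : A) (T : {vspace A}) : (T <= limg (delta mu))%VS ->
  exists f : 'I_(\dim T) -> R, alg_indep (GL_orbit mu) f.
Proof.
move=> TB; pose b := vbasis T; have b_free : free b := basis_free (vbasisP T).
have Hxi (j : 'I_(\dim T)) : exists xi, gl_act xi mu = b`_j.
  have /(subvP TB)/memv_imgP[xi _ xiE] : b`_j \in T by apply/vbasis_mem/memt_nth.
  by exists xi; rewrite xiE deltaE.
have [xi xiE] := choice Hxi.
have l_lin i : linear (coord b i : A -> k^o) by move=> a u v; rewrite linearP.
pose f i : R := linpoly (coord b i).
exists f.
apply: (@alg_indep_of_jacobian k char0 A (GL_orbit mu) mu _ f (fun j x => gl_act (xi j) x)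
  (fun i j => linpoly (fun x => coord b i (gl_act (xi j) x)))).
- exact: orbit_vanishing_prime.
- by move=> p j x p0 Ox; apply: orbit_tangent Ox p0.
- move=> i j x; rewrite pdiff_linpoly // peval_linpoly // => a u v.
  by rewrite gl_act_linear linearP.
- exact: GL_orbit_refl.
rewrite (_ : \matrix_(_, _) _ = 1%:M) ?det1 ?oner_eq0 //; apply/matrixP => i j.
rewrite !mxE peval_linpoly => [|a u v]; last by rewrite gl_act_linear linearP.
by rewrite xiE coord_free // eq_sym.
Qed.

Lemma linear_pullback (L : A -> A) (p : R) : linear L ->
  exists p' : R, forall v, peval p' v = peval p (L v).
Proof.
move=> L_lin; exists (p \mPo [tuple linpoly (fun v => coords (L v) i) | i < n]) => v.
rewrite peval_comp; apply: meval_eq => i; rewrite peval_linpoly // => a u w.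
by rewrite L_lin /coords linearP.
Qed.

Lemma orbit_Var (x y : A) : Var Q x -> GL_orbit x y -> Var Q y.
Proof.
move=> Xx [g gI ->] q qQ.
have gVI : GL (g^-1)%VF.
  by apply/lker0P; apply: can_inj (lker0_lfunVK gI).
have := Xx _ (Qstable gVI qQ); rewrite bform_actE.
by have [_ ->] := inverse_pair_GL (conj (lker0_compVf gI) (lker0_compfV gI)).
Qed.

Lemma zclosed_vanishing (Y : A -> Prop) :
  zclosed (fun v => forall p : R, vanishing_ideal Y p -> peval p v = 0).
Proof. by exists (vanishing_ideal Y). Qed.

(** The closure Y of GL(W) Z is irreducible and contained in Var(Q), so it equals
    Z by maximality. If Y were covered by closed sets C and D without being
    contained in one, functions p and q vanishing on C and D would be nonzero at
    g1 z1 and g2 z2; as Z is irreducible, z1 and z2 can be replaced by one point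
    z3, and then p q vanishes on the irreducible orbit of z3. *)
Lemma component_GL_stable (Z : A -> Prop) : irreducible_component (Var Q) Z ->
  forall z y, Z z -> GL_orbit z y -> Z y.
Proof.
move=> [[Zcl Zirr] ZX Zmax] z y Zz zy.
pose GZ v := exists2 z, Z z & GL_orbit z v.
pose Y v := forall p : R, vanishing_ideal GZ p -> peval p v = 0.
have GZY v : GZ v -> Y v by move=> Gv p; apply.
have ZY : zsub Z Y by move=> v Zv; apply: GZY; exists v => //; apply: GL_orbit_refl.
apply: (Zmax Y _ _ ZY) => //; last by apply: GZY; exists z.
  split; first exact: zclosed_vanishing.
  split=> [|C D Ccl Dcl YCD]; first by exists z; apply: ZY.
  have sep E : zclosed E -> ~ zsub Y E ->
      exists p z g h, [/\ vanishing_ideal E p, Z z, inverse_pair g h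
        & peval p (transport g h z) != 0].
    move=> [S ES] nYE; apply: contrapT => no; apply: nYE => v Yv; apply/ES => p Sp.
    apply: Yv => w [z' Zz' /GL_orbitP[g [h [gh wE]]]]; apply/eqP/negPn/negP => pw; apply: no.
    by exists p, z', g, h; split=> //; [move=> u /ES; apply | rewrite -wE].
  have [?|/(sep _ Ccl)[p [z1 [g1 [h1 [pC Zz1 gh1 p1]]]]]] := pselect (zsub Y C); first by left.
  have [?|/(sep _ Dcl)[q [z2 [g2 [h2 [qD Zz2 gh2 q2]]]]]] := pselect (zsub Y D); first by right.
  have [p' p'E] := linear_pullback p (transport_linear g1 h1).
  have [q' q'E] := linear_pullback q (transport_linear g2 h2).
  have [z3 Zz3] : exists2 z3, Z z3 & peval (p' * q') z3 != 0.
    apply: not_vanishing_point => /(vanishing_prime Zirr)[/(_ _ Zz1)|/(_ _ Zz2)] /eqP.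
      by rewrite p'E (negPf p1).
    by rewrite q'E (negPf q2).
  rewrite pevalM mulf_eq0 negb_or p'E q'E => /andP[p3 q3].
  have [] : vanishing_ideal (GL_orbit z3) p \/ vanishing_ideal (GL_orbit z3) q.
    apply: (orbit_vanishing_prime char0) => v z3v; rewrite pevalM.
    have /YCD[/pC ->|/qD ->] : Y v by apply: GZY; exists z3.
      by rewrite mul0r.
    by rewrite mulr0.
  - by move=> H; move/eqP: p3; case; apply: H; apply/GL_orbitP; exists g1, h1.
  - by move=> H; move/eqP: q3; case; apply: H; apply/GL_orbitP; exists g2, h2.
move=> v Yv q qQ; rewrite -peval_qpoly; apply: Yv => w [z' Zz' z'w].
by rewrite peval_qpoly; apply: orbit_Var z'w _ qQ; apply: ZX.
Qed.

End OrbitInComponent.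

(** * Definability and openness of the dense orbit *)

Section Definable.

Variables (k : closedFieldType) (V : vectType k).
Local Notation n := (\dim (fullv : {vspace V})).
Local Notation R := {mpoly k[n]}.

Definition env (v : V) : seq k := [seq coords v i | i <- enum 'I_n].

Lemma size_env v : size (env v) = n.
Proof. by rewrite size_map size_enum_ord. Qed.

Lemma nth_env v (i : 'I_n) : (env v)`_i = coords v i.
Proof. by rewrite (nth_map i) ?size_enum_ord // nth_ord_enum. Qed.

Lemma eval_term_poly (t : GRing.term k) : GRing.rterm t ->
  exists p : R, forall v, GRing.eval (env v) t = peval p v.
Proof.
elim: t => [i|a|m|t1 IH1 t2 IH2|t IH|t IH m|t1 IH1 t2 IH2|t IH|t IH m] //=.
- move=> _; have [lt|le] := ltnP i n.
    by exists 'X_(Ordinal lt) => v; rewrite pevalX -nth_env.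
  by exists 0 => v; rewrite nth_default ?size_env // /peval meval0.
- by exists a%:MP => v; rewrite pevalC.
- by exists m%:R%:MP => v; rewrite pevalC.
- case/andP=> /IH1[p pE] /IH2[q qE]; exists (p + q) => v.
  by rewrite pE qE pevalD.
- by case/IH => p pE; exists (- p) => v; rewrite pE /peval mevalN.
- by case/IH => p pE; exists (p *+ m) => v; rewrite pE /peval mevalMn.
- case/andP=> /IH1[p pE] /IH2[q qE]; exists (p * q) => v.
  by rewrite pE qE pevalM.
- by case/IH => p pE; exists (p ^+ m) => v; rewrite pE /peval rmorphXn.
Qed.

Lemma generic_truth_qf (Z : V -> Prop) (f : GRing.formula k) :
    irreducible Z -> GRing.qf_form f -> GRing.rformula f ->
  exists b tau, ~ vanishing_ideal Z b /\
    forall v, Z v -> peval b v != 0 -> GRing.qf_eval (env v) f = tau.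
Proof.
move=> Zirr.
have one : ~ vanishing_ideal Z (1 : R).
  by have [[z Zz] _] := Zirr; move/(_ z Zz)/eqP; rewrite /peval meval1 oner_eq0.
have two (f1 f2 : GRing.formula k) (op : bool -> bool -> bool) :
    (exists b tau, ~ vanishing_ideal Z b /\
      forall v, Z v -> peval b v != 0 -> GRing.qf_eval (env v) f1 = tau) ->
    (exists b tau, ~ vanishing_ideal Z b /\
      forall v, Z v -> peval b v != 0 -> GRing.qf_eval (env v) f2 = tau) ->
    exists b tau, ~ vanishing_ideal Z b /\ forall v, Z v -> peval b v != 0 ->
      op (GRing.qf_eval (env v) f1) (GRing.qf_eval (env v) f2) = tau.
  move=> [b1 [tau1 [b1Z H1]]] [b2 [tau2 [b2Z H2]]]; exists (b1 * b2), (op tau1 tau2).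
  split=> [/(vanishing_prime Zirr)[]//|v Zv].
  by rewrite pevalM mulf_eq0 negb_or => /andP[/(H1 v Zv) -> /(H2 v Zv) ->].
elim: f => [t|t1 t2|t|f1 IH1 f2 IH2|f1 IH1 f2 IH2|f1 IH1 f2 IH2|f IH|//|//] //=.
- by move=> _ _; exists 1, t.
- move=> _ /andP[/eval_term_poly[p pE] /eval_term_poly[q qE]].
  have [pq|pq] := pselect (vanishing_ideal Z (p - q)).
    exists 1, true; split=> // v Zv _; rewrite pE qE -subr_eq0 -pevalB.
    exact/eqP/pq.
  exists (p - q), false; split=> // v Zv; rewrite pevalB subr_eq0 pE qE.
  exact: negPf.
- by move=> /andP[/IH1 H1 /IH2 H2] /andP[/H1{}H1 /H2{}H2]; apply: (two _ _ andb).
- by move=> /andP[/IH1 H1 /IH2 H2] /andP[/H1{}H1 /H2{}H2]; apply: (two _ _ orb).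
- by move=> /andP[/IH1 H1 /IH2 H2] /andP[/H1{}H1 /H2{}H2]; apply: (two _ _ implb).
- move=> /IH H /H[b [tau [bZ bE]]]; exists b, (~~ tau).
  by split=> // v Zv bv; rewrite bE.
Qed.

(** Quantifier elimination reduces this to boolean combinations of equations. An
    equation either holds on all of Z or fails wherever its polynomial is nonzero;
    since I is prime, finitely many such open conditions have a common point. *)
Lemma generic_truth (Z : V -> Prop) (f : GRing.formula k) : irreducible Z ->
  exists b (tau : bool), ~ vanishing_ideal Z b /\
    forall v, Z v -> peval b v != 0 -> (GRing.holds (env v) f <-> tau).
Proof.
move=> Zirr; pose proj := @ClosedFieldQE.ex_elim k.
have wf : GRing.wf_QE_proj proj := @ClosedFieldQE.wf_ex_elim k.
have ok : GRing.valid_QE_proj proj.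
  by apply: ClosedFieldQE.holds_ex_elim; apply: solve_monicpoly.
pose f' := GRing.to_rform f.
have rf' : GRing.rformula f' by apply: GRing.to_rform_rformula.
have /andP[qf rqf] := GRing.quantifier_elim_wf wf rf'.
have [b [tau [bZ bE]]] := generic_truth_qf Zirr qf rqf.
exists b, tau; split=> // v Zv bv; rewrite -(bE v Zv bv).
have H := GRing.quantifier_elim_rformP wf ok (env v) rf'.
by split=> [/GRing.to_rformP/H|/H/GRing.to_rformP].
Qed.

End Definable.

Section OrbitDefinable.

Variables (k : closedFieldType) (W : vectType k) (c : law_kind).
Local Notation A := (law_space W c).
Local Notation n := (\dim (fullv : {vspace A})).
Local Notation m := (\dim (fullv : {vspace 'End(W)})).

Definition term_fun (f : seq k -> k) (d : k) : Prop :=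
  exists t : GRing.term k, forall e, f e = GRing.eval e t.

Lemma term_fun_jet_class : jet_class [::] term_fun.
Proof.
split=> [a|f d g e [t ft] [u gu]|f d g e [t ft] [u gu]].
- by exists (GRing.Const a).
- by exists (GRing.Add t u) => s; rewrite ft gu.
- by exists (GRing.Mul t u) => s; rewrite ft gu.
Qed.

Definition conj_formula r (F : 'I_r -> GRing.formula k) : GRing.formula k :=
  foldr GRing.And (GRing.Bool true) [seq F i | i <- enum 'I_r].

Lemma holds_conj_formula r (F : 'I_r -> GRing.formula k) e :
  GRing.holds e (conj_formula F) <-> forall i, GRing.holds e (F i).
Proof.
have H (s : seq 'I_r) :
    GRing.holds e (foldr GRing.And (GRing.Bool true) [seq F i | i <- s]) <->
    forall i, i \in s -> GRing.holds e (F i).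
  elim: s => //= i s IH; split=> [[Fi /IH Fs] j|Fis].
    by rewrite inE => /predU1P[->|/Fs].
  by split; [apply: Fis (mem_head _ _) | apply/IH => j js; apply: Fis; rewrite inE js orbT].
by split=> [/H F_ i|F_]; [apply: F_; rewrite mem_enum | apply/H].
Qed.

Definition read_End (s : nat) (e : seq k) : 'End(W) :=
  \sum_(j < m) e`_(s + j) *: (vbasis (fullv : {vspace 'End(W)}))`_j.

Lemma read_End_jet s : exists d, vjet term_fun (read_End s) d.
Proof.
have var j : term_fun (fun e => e`_(s + j)) 0 by exists (GRing.Var k (s + j)).
eexists; exact: (vjet_sum term_fun_jet_class _
  (fun j : 'I_m => vjetZ term_fun_jet_class _ (var j))).
Qed.

Lemma coords_terms (U : vectType k) (F : seq k -> U) d : vjet term_fun F d ->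
  exists t : 'I_(\dim (fullv : {vspace U})) -> GRing.term k,
    forall e i, coords (F e) i = GRing.eval e (t i).
Proof. by move=> /choice[t tE]; exists t. Qed.

(** The formula quantifies over the coordinates of g and of its inverse h, stored
    right after those of v: g h = h g = 1 and v = transport g h mu. *)
Lemma GL_orbit_definable (mu : A) : exists f, forall v, GL_orbit mu v <-> GRing.holds (env v) f.
Proof.
have [g' Gf] := read_End_jet n; have [h' Hf] := read_End_jet (n + m).
set G := read_End n in Gf; set H := read_End (n + m) in Hf.
have [t tE] := coords_terms (vjet_transport term_fun_jet_class mu Gf Hf).
have lin1 (h : 'End(W)) : linear (fun g : 'End(W) => (g \o h)%VF).
  by move=> a u v; rewrite comp_lfunDl -comp_lfunZl.
have lin2 (g : 'End(W)) : linear (fun h : 'End(W) => (g \o h)%VF).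
  by move=> a u v; rewrite comp_lfunDr -comp_lfunZr.
have [u uE] := coords_terms (vjet_bilinear term_fun_jet_class
  (B := fun g h : 'End(W) => (g \o h)%VF) lin1 lin2 Gf Hf).
have [w wE] := coords_terms (vjet_bilinear term_fun_jet_class
  (B := fun g h : 'End(W) => (g \o h)%VF) lin1 lin2 Hf Gf).
pose one i := GRing.Const (coords (\1%VF : 'End(W)) i).
pose body := GRing.And (conj_formula (fun i : 'I_n => GRing.Equal (GRing.Var k i) (t i)))
  (GRing.And (conj_formula (fun i => GRing.Equal (u i) (one i)))
             (conj_formula (fun i => GRing.Equal (w i) (one i)))).
exists (foldr GRing.Exists body (iota n (m + m))) => v; split.
  move=> /GL_orbitP[g [h [[gh hg] vE]]]; apply/GRing.foldExistsP.
  pose e := env v ++ [seq coords g j | j <- enum 'I_m] ++ [seq coords h j | j <- enum 'I_m].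
  have size_e : size e = (n + (m + m))%N.
    by rewrite /e !size_cat size_env size_map size_enum_ord size_map size_enum_ord.
  have Ge : G e = g.
    rewrite [RHS]coords_sum; apply: eq_bigr => j _; congr (_ *: _).
    rewrite nth_cat size_env ltnNge leq_addr /= addKn nth_cat size_map size_enum_ord ltn_ord.
    by rewrite (nth_map j) ?size_enum_ord // nth_ord_enum.
  have He : H e = h.
    rewrite [RHS]coords_sum; apply: eq_bigr => j _; congr (_ *: _).
    rewrite nth_cat size_env -addnA ltnNge leq_addr /= addKn nth_cat size_map size_enum_ord.
    rewrite ltnNge leq_addr /= addKn.
    by rewrite (nth_map j) ?size_enum_ord // nth_ord_enum.
  exists e.
    move=> i; rewrite !inE mem_iota -[~~ _]/(~~ (_ && _)) negb_and -ltnNge -leqNgt.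
    have [lt _|le /= le2] := ltnP i n; first by rewrite nth_cat size_env lt.
    by rewrite !nth_default ?size_env ?size_e.
  split; last split; apply/holds_conj_formula => i /=.
  - by rewrite -tE Ge He -vE nth_cat size_env ltn_ord nth_env.
  - by rewrite -uE Ge He gh.
  - by rewrite -wE Ge He hg.
move=> /GRing.foldExistsP[e ve [/holds_conj_formula vt
  [/holds_conj_formula gh /holds_conj_formula hg]]].
apply/GL_orbitP; exists (G e), (H e); split.
  by split; apply: coords_inj => i; [rewrite uE; apply: gh | rewrite wE; apply: hg].
apply: coords_inj => i; rewrite tE -(vt i) /= -ve ?nth_env //.
by rewrite !inE mem_iota negb_and -ltnNge ltn_ord.
Qed.

End OrbitDefinable.

Section DenseOrbit.

Variables (k : closedFieldType) (W : vectType k) (c : law_kind).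
Local Notation A := (law_space W c).
Local Notation n := (\dim (fullv : {vspace A})).

(** There is a function b, not vanishing identically on Z, such that membership
    in the orbit is constant on the points of Z where b is nonzero; by density
    the constant is truth. The complement of the orbit in Z is then the closed
    set where all translates of b vanish. *)
Lemma dense_orbit_open (Z : A -> Prop) (mu : A) : irreducible Z ->
    (forall z y, Z z -> GL_orbit z y -> Z y) -> Z mu ->
    (forall p, vanishing_ideal (GL_orbit mu) p -> vanishing_ideal Z p) ->
  open_in Z (GL_orbit mu).
Proof.
move=> Zirr Zstable Zmu dense.
have [f fE] := GL_orbit_definable mu.
have [b [tau [bZ bE]]] := generic_truth f Zirr.
have OZ v : GL_orbit mu v -> Z v by apply: Zstable.
(* If the constant were falsehood, b would vanish on the orbit, hence on Z. *)
have bO v : Z v -> peval b v != 0 -> GL_orbit mu v.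
  move=> Zv bv; apply/fE/(bE v Zv bv); apply/negPn/negP => tau0; apply: bZ; apply: dense.
  move=> w Ow; apply/eqP/negPn/negP => bw; move/negP: tau0; apply.
  exact/(bE w (OZ w Ow) bw)/fE.
have [z Zz bz] := not_vanishing_point bZ; have Oz := bO z Zz bz.
exists (fun v => forall g h, inverse_pair g h -> peval b (transport g h v) = 0).
  exists (fun p => exists g h, inverse_pair g h /\
    forall v : A, peval p v = peval b (transport g h v)) => v; split.
    by move=> Cv p [g [h [gh ->]]]; apply: Cv.
  move=> Sv g h gh; have [p pE] := linear_pullback b (transport_linear g h).
  by rewrite -pE; apply: Sv; exists g, h.
move=> v; split=> [Ov|[Zv nCv]].
  split=> [|Cv]; first exact: OZ.
  have /GL_orbitP[g [h [gh zE]]] := GL_orbit_trans (GL_orbit_sym Ov) Oz.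
  by move: bz; rewrite zE Cv ?eqxx.
have [g [h [gh bv]]] : exists g h, inverse_pair g h /\ peval b (transport g h v) != 0.
  apply: contrapT => no; apply: nCv => g h gh; apply/eqP/negPn/negP => bv.
  by apply: no; exists g, h.
have vy : GL_orbit v (transport g h v) by apply/GL_orbitP; exists g, h.
exact: GL_orbit_trans (bO _ (Zstable _ _ Zv vy) bv) (GL_orbit_sym vy).
Qed.

End DenseOrbit.

Theorem theorem3p6 (k : closedFieldType) (char0 : [pchar k]%R =i pred0)
    (W : vectType k) (c : law_kind)
    (Q : {vspace bform W c}) (Qsym : (Q <= symmetric_forms W c)%VS)
    (Qstable : GL_stable Q)
    (mu : law_space W c) (Xmu : Var Q mu)
    (Z : law_space W c -> Prop)
    (Zcomp : irreducible_component (Var Q) Z) (Zmu : Z mu)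
    (Zsmooth : smooth_point Z mu)
    (mu_aniso : anisotropic Q mu) :
  open_in Z (GL_orbit mu).
Proof.
have [[_ Zirr] ZX _] := Zcomp.
have Zstable := component_GL_stable char0 Qstable Zcomp.
apply: dense_orbit_open => // p Op; apply: contrapT => Zp.
have tangent_delta := tangent_in_limg_delta char0 Qsym Qstable Xmu Zirr ZX Zsmooth mu_aniso.
have [_ [d _ Td]] := Zsmooth; have [T TP dimT] := Td.
have TB : (T <= limg (delta mu))%VS by apply/subvP => v /TP; apply: tangent_delta.
have [f Of] := alg_indep_orbit char0 TB.
have OZ : zsub (GL_orbit mu) Z by move=> v; apply: Zstable.
have Zf := alg_indep_cons Zirr OZ Of Op Zp.
by have := alg_indep_le_tangent_dim char0 Zirr Zmu Td Zf; rewrite dimT ltnn.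
Qed.
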